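(* Let $\mathcal A$ be an abelian category. Then the Waldhausen $S_\bullet$-construction $S_\bullet\mathcal A:\boldsymbol{\Delta}^{\mathrm{op}}\to\mathcal S$ is a decomposition space.
   Context: $\mathcal S$ is the $\infty$-category of $\infty$-groupoids (spaces); groupoids are regarded as $\infty$-groupoids, and pullbacks are $\infty$-categorical (homotopy) pullbacks. $\boldsymbol{\Delta}$ is the category of nonempty finite ordinals $[k]=\{0,\dots,k\}$ and monotone maps; a simplicial space is a functor $\boldsymbol{\Delta}^{\mathrm{op}}\to\mathcal S$. A map $g:[m]\to[n]$ in $\boldsymbol{\Delta}$ is active if $g(0)=0$ and $g(m)=n$, and $f:[m]\to[n]$ is inert if $f(i+1)=f(i)+1$ for $0\le i\le m-1$. Active and inert maps admit pushouts along each other in $\boldsymbol{\Delta}$. A decomposition space is a simplicial space sending every pushout square in $\boldsymbol{\Delta}$ of an active map along an inert map to a pullback square in $\mathcal S$. For a linearly ordered set $I$, $\mathrm{Ar}(I)$ is the category of arrows in $I$: its objects are pairs $(i,j)$ with $i\le j$ in $I$, with a unique morphism $(i,j)\to(i',j')$ whenever $i\le i'$ and $j\le j'$. A gap complex in $\mathcal A$ is a functor $F:\mathrm{Ar}(I)\to\mathcal A$ such that (1) each $F(i,i)$ is a zero object, and (2) for all $i\le j\le k$ the square with corners $F(i,j)$, $F(i,k)$, $F(j,j)\simeq 0$, $F(j,k)$ has monic horizontal maps $F(i,j)\to F(i,k)$ and $F(j,j)\to F(j,k)$, epic vertical maps $F(i,j)\to F(j,j)$ and $F(i,k)\to F(j,k)$,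 and is a pushout (equivalently a pullback); in other words, $F(i,j)\to F(i,k)\to F(j,k)$ is a short exact sequence. $\mathrm{Gap}(I,\mathcal A)$ is the full subcategory of $\mathrm{Fun}(\mathrm{Ar}(I),\mathcal A)$ on the gap complexes, and $\mathrm{Gap}(I,\mathcal A)^{\mathrm{eq}}$ its maximal subgroupoid. The Waldhausen $S_\bullet$-construction of $\mathcal A$ is the simplicial space $S_\bullet\mathcal A$, $[n]\mapsto \mathrm{Gap}([n],\mathcal A)^{\mathrm{eq}}$. *)

(* Defs.v *)
Set Warnings "-notation-overridden".
From HB Require Import structures.
From mathcomp Require Import all_boot all_order.
From mathcomp Require Import boolp.

Set Implicit Arguments.
Unset Strict Implicit.
Unset Printing Implicit Defensive.
Set Primitive Projections.

Import Order.TTheory.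

#[local] Obligation Tactic := simpl; try by [].

Record Category := {
  ob :> Type;
  hom : ob -> ob -> Type;
  idm : forall x, hom x x;
  comp : forall x y z, hom y z -> hom x y -> hom x z;
  comp_idl : forall x y (f : hom x y), comp (idm y) f = f;
  comp_idr : forall x y (f : hom x y), comp f (idm x) = f;
  comp_assoc : forall w x y z (h : hom y z) (g : hom x y) (f : hom w x),
    comp h (comp g f) = comp (comp h g) f }.

Arguments hom {c} x y.
Arguments idm {c} x.
Arguments comp {c x y z} g f.

Notation "g ∘ f" := (comp g f) (at level 40, left associativity).

Section CategoricalNotions.
Variable C : Category.

Definition is_mono (x y : C) (f : hom x y) : Prop :=
  forall w (u v : hom w x), f ∘ u = f ∘ v -> u = v.

Definition is_epi (x y : C) (f : hom x y) : Prop :=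
  forall z (u v : hom y z), u ∘ f = v ∘ f -> u = v.

Definition is_initial (x : C) : Prop :=
  forall y, exists f : hom x y, forall g, g = f.

Definition is_terminal (x : C) : Prop :=
  forall y, exists f : hom y x, forall g, g = f.

Definition is_zero_object (x : C) : Prop := is_initial x /\ is_terminal x.

(*  a --f--> b
    |g       |g'
    v        v
    c --f'-> d  *)
Definition is_pushout (a b c d : C) (f : hom a b) (g : hom a c)
    (f' : hom c d) (g' : hom b d) : Prop :=
  g' ∘ f = f' ∘ g /\
  forall e (u : hom b e) (v : hom c e), u ∘ f = v ∘ g ->
    exists! w : hom d e, w ∘ g' = u /\ w ∘ f' = v.

End CategoricalNotions.

Record Functor (C D : Category) := {
  fob :> C -> D;
  fmap : forall x y, hom x y -> hom (fob x) (fob y);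
  fmap_id : forall x, fmap (idm x) = idm (fob x);
  fmap_comp : forall x y z (g : hom y z) (f : hom x y),
    fmap (g ∘ f) = fmap g ∘ fmap f }.

Arguments fmap {C D} _ {x y} _.

Program Definition comp_functor (B C D : Category)
    (G : Functor C D) (F : Functor B C) : Functor B D :=
  {| fob x := G (F x); fmap x y f := fmap G (fmap F f) |}.
Next Obligation. by move=> *; rewrite !fmap_id. Qed.
Next Obligation. by move=> *; rewrite !fmap_comp. Qed.

Record NatTrans (C D : Category) (F G : Functor C D) := {
  nt :> forall x, hom (F x) (G x);
  nt_natural : forall x y (f : hom x y), nt y ∘ fmap F f = fmap G f ∘ nt x }.

Lemma nt_ext (C D : Category) (F G : Functor C D) (s t : NatTrans F G) :
  (forall x, s x = t x) -> s = t.
Proof.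
case: s => s sP; case: t => t tP /= st.
have {}st : s = t by apply: functional_extensionality_dep.
by subst t; rewrite (Prop_irrelevance sP tP).
Qed.

Definition hcast (C : Category) (x x' y y' : C) (p : x = x') (q : y = y')
    (f : hom x y) : hom x' y' :=
  match p in _ = a, q in _ = b return hom a b with
  | erefl, erefl => f
  end.

Lemma hcast_id (C : Category) (x y : C) (p : x = x) (q : y = y)
  (f : hom x y) : hcast p q f = f.
Proof. by rewrite (Prop_irrelevance p erefl) (Prop_irrelevance q erefl). Qed.

Lemma functor_ext (C D : Category) (F G : Functor C D)
  (e : forall x, F x = G x) :
  (forall x y (f : hom x y), hcast (e x) (e y) (fmap F f) = fmap G f) -> F = G.
Proof.
case: F e => F F1 F2 F3; case: G => G G1 G2 G3 /= e FG.
have E : F = G by apply: funext.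
subst G; have E1 : F1 = G1.
  apply: functional_extensionality_dep => x.
  apply: functional_extensionality_dep => y.
  by apply: funext => f; rewrite -FG hcast_id.
subst G1.
by rewrite (Prop_irrelevance F2 G2) (Prop_irrelevance F3 G3).
Qed.

Program Definition functor_cat (C D : Category) : Category :=
  {| ob := Functor C D;
     hom F G := NatTrans F G;
     idm F := {| nt x := idm (F x) |};
     comp F G H t s := {| nt x := t x ∘ s x |} |}.
Next Obligation. by move=> *; rewrite comp_idl comp_idr. Qed.
Next Obligation.
move=> C D F G H t s x y f.
by rewrite -comp_assoc (nt_natural s) comp_assoc (nt_natural t) comp_assoc.
Qed.
Next Obligation. by move=> *; apply: nt_ext => x /=; rewrite comp_idl. Qed.
Next Obligation. by move=> *; apply: nt_ext => x /=; rewrite comp_idr. Qed.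
Next Obligation. by move=> *; apply: nt_ext => x /=; rewrite comp_assoc. Qed.

Program Definition full_subcat (C : Category) (P : C -> Prop) : Category :=
  {| ob := {x : C | P x};
     hom x y := hom (proj1_sig x) (proj1_sig y);
     idm x := idm (proj1_sig x);
     comp x y z g f := g ∘ f |}.
Next Obligation. by move=> *; exact: comp_idl. Qed.
Next Obligation. by move=> *; exact: comp_idr. Qed.
Next Obligation. by move=> *; exact: comp_assoc. Qed.

Record Groupoid := {
  gcat :> Category;
  ginv : forall x y : gcat, hom x y -> hom y x;
  ginvl : forall (x y : gcat) (f : hom x y), ginv f ∘ f = idm x;
  ginvr : forall (x y : gcat) (f : hom x y), f ∘ ginv f = idm y }.

Record Iso (C : Category) (x y : C) := {
  iso_hom :> hom x y;
  iso_inv : hom y x;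
  iso_invl : iso_inv ∘ iso_hom = idm x;
  iso_invr : iso_hom ∘ iso_inv = idm y }.

Lemma iso_ext (C : Category) (x y : C) (f g : Iso x y) :
  iso_hom f = iso_hom g -> f = g.
Proof.
case: f => f f' fl fr; case: g => g g' gl gr /= fg; subst g.
have E : f' = g' by rewrite -[f']comp_idr -gr comp_assoc fl comp_idl.
by subst g'; rewrite (Prop_irrelevance fl gl) (Prop_irrelevance fr gr).
Qed.

Program Definition core_cat (C : Category) : Category :=
  {| ob := C;
     hom x y := @Iso C x y;
     idm x := {| iso_hom := idm x; iso_inv := idm x |};
     comp x y z g f := {| iso_hom := iso_hom g ∘ iso_hom f;
                          iso_inv := iso_inv f ∘ iso_inv g |} |}.
Next Obligation. by move=> *; rewrite comp_idl. Qed.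
Next Obligation. by move=> *; rewrite comp_idl. Qed.
Next Obligation.
move=> C x y z g f.
by rewrite -comp_assoc (comp_assoc (iso_inv g)) iso_invl comp_idl iso_invl.
Qed.
Next Obligation.
move=> C x y z g f.
by rewrite -comp_assoc (comp_assoc (iso_hom f)) iso_invr comp_idl iso_invr.
Qed.
Next Obligation. by move=> *; apply: iso_ext; rewrite /= comp_idl. Qed.
Next Obligation. by move=> *; apply: iso_ext; rewrite /= comp_idr. Qed.
Next Obligation. by move=> *; apply: iso_ext; rewrite /= comp_assoc. Qed.

(* The maximal subgroupoid. *)
Program Definition core (C : Category) : Groupoid :=
  {| gcat := core_cat C;
     ginv x y f := {| iso_hom := iso_inv f; iso_inv := iso_hom f |} |}.
Next Obligation. by move=> *; exact: iso_invr. Qed.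
Next Obligation. by move=> *; exact: iso_invl. Qed.
Next Obligation. by move=> *; apply: iso_ext; exact: iso_invl. Qed.
Next Obligation. by move=> *; apply: iso_ext; exact: iso_invr. Qed.

Program Definition core_functor (C D : Category) (F : Functor C D) :
    Functor (core C) (core D) :=
  {| fob x := F x : core D;
     fmap x y f := {| iso_hom := fmap F (iso_hom f);
                      iso_inv := fmap F (iso_inv f) |} |}.
Next Obligation. by move=> *; rewrite -fmap_comp iso_invl fmap_id. Qed.
Next Obligation. by move=> *; rewrite -fmap_comp iso_invr fmap_id. Qed.
Next Obligation. by move=> *; apply: iso_ext; rewrite /= fmap_id. Qed.
Next Obligation. by move=> *; apply: iso_ext; rewrite /= fmap_comp. Qed.

Program Definition thin_cat (T : Type) (R : rel T)
    (Rrefl : reflexive R) (Rtrans : transitive R) : Category :=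
  {| ob := T;
     hom x y := R x y;
     idm x := Rrefl x;
     comp x y z g f := Rtrans y x z f g |}.

Record MonoMap d (I : orderType d) d' (J : orderType d') := {
  mfun :> I -> J;
  mfun_le : forall i j : I, (i <= j)%O -> (mfun i <= mfun j)%O }.

Lemma mono_ext d (I : orderType d) d' (J : orderType d') (f g : MonoMap I J) :
  (forall i, f i = g i) -> f = g.
Proof.
case: f => f fP; case: g => g gP /= fg.
have E : f = g by apply: funext.
by subst g; rewrite (Prop_irrelevance fP gP).
Qed.

Definition mono_id d (I : orderType d) : MonoMap I I :=
  {| mfun i := i; mfun_le i j le := le |}.

Definition mono_comp d (I : orderType d) d' (J : orderType d')
    d'' (K : orderType d'') (g : MonoMap J K) (f : MonoMap I J) : MonoMap I K :=
  {| mfun i := g (f i); mfun_le i j le := mfun_le g (mfun_le f le) |}.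

Definition mono_cst d (I : orderType d) d' (J : orderType d') (j : J) :
    MonoMap I J :=
  {| mfun i := j; mfun_le _ _ _ := lexx j |}.

(* The object k : nat stands for [k] = {0, ..., k}. *)
Program Definition Delta : Category :=
  {| ob := nat;
     hom m n := MonoMap 'I_m.+1 'I_n.+1;
     idm n := mono_id 'I_n.+1;
     comp l m n g f := mono_comp g f |}.

Definition active (m n : Delta) (g : hom m n) : Prop :=
  g ord0 = ord0 /\ g ord_max = ord_max.

Definition inert (m n : Delta) (f : hom m n) : Prop :=
  forall i j : 'I_m.+1, j = i.+1 :> nat -> f j = (f i).+1 :> nat.

(* Infinity-groupoids are modelled by Kan complexes. *)

Record sSet := {
  cell :> nat -> Type;
  sact : forall m n (a : @hom Delta m n), cell n -> cell m;
  sact_id : forall n (x : cell n), sact (@idm Delta n) x = x;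
  sact_comp : forall l m n (b : @hom Delta m n) (a : @hom Delta l m) (x : cell n),
    sact (b ∘ a) x = sact a (sact b x) }.

Arguments sact {_ m n} a x.

Record sMap (X Y : sSet) := {
  smap :> forall n, X n -> Y n;
  smap_act : forall m n (a : @hom Delta m n) (x : X n),
    smap (sact a x) = sact a (smap x) }.

Definition smap_id (X : sSet) : sMap X X :=
  {| smap n x := x; smap_act m n a x := erefl |}.

Program Definition smap_comp (X Y Z : sSet) (g : sMap Y Z) (f : sMap X Y) :
    sMap X Z :=
  {| smap n x := g n (f n x) |}.
Next Obligation. by move=> *; rewrite !smap_act. Qed.

Lemma smap_ext (X Y : sSet) (f g : sMap X Y) :
  (forall n (x : X n), f n x = g n x) -> f = g.
Proof.
case: f => f fP; case: g => g gP /= fg.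
have E : f = g.
  by apply: functional_extensionality_dep => n; apply: funext.
by subst g; rewrite (Prop_irrelevance fP gP).
Qed.

Program Definition simplex (n : nat) : sSet :=
  {| cell k := @hom Delta k n; sact j k a t := t ∘ a |}.

Program Definition sprod (X Y : sSet) : sSet :=
  {| cell k := (X k * Y k)%type; sact j k a x := (sact a x.1, sact a x.2) |}.
Next Obligation. by move=> X Y n [x y]; rewrite /= !sact_id. Qed.
Next Obligation. by move=> *; rewrite /= !sact_comp. Qed.

Definition sprod_map (X X' Y Y' : sSet) (f : sMap X X') (g : sMap Y Y') :
    sMap (sprod X Y) (sprod X' Y').
Proof.
refine {| smap n (x : sprod X Y n) := (f n x.1, g n x.2) : sprod X' Y' n |}.
by move=> m n a [x y]; rewrite /= !smap_act.
Defined.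

Definition simplex_map (m n : nat) (a : @hom Delta m n) :
    sMap (simplex m) (simplex n) :=
  {| smap k (t : simplex m k) := (a ∘ t : simplex n k);
     smap_act _ _ _ _ := erefl |}.

(* The k-th horn of the standard n-simplex: the simplices missing some
   vertex other than k. *)
Program Definition horn (n : nat) (k : 'I_n.+1) : sSet :=
  {| cell j := {t : @hom Delta j n |
                  exists i : 'I_n.+1, i <> k /\ forall a, t a <> i};
     sact i j a t := exist _ (proj1_sig t ∘ a) _ |}.
Next Obligation.
by move=> n k i j a [t [v [vk tv]]] /=; exists v; split => // b; apply: tv.
Qed.
Next Obligation. by move=> n k i [t tP]; apply: eq_exist. Qed.
Next Obligation. by move=> n k l i j b a [t tP]; apply: eq_exist. Qed.

Definition is_kan (X : sSet) : Prop :=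
  forall n (k : 'I_n.+2) (h : sMap (horn k) X),
    exists x : X n.+1, forall j (t : horn k j), h j t = sact (proj1_sig t) x.

Record Space := {
  space_sset :> sSet;
  space_kan : is_kan space_sset }.

(* Homotopies between maps of simplicial sets; the vertices of the interval
   are the two constant maps to [1]. *)
Definition end0 (k : nat) : simplex 1 k := mono_cst _ ord0.
Definition end1 (k : nat) : simplex 1 k := mono_cst _ ord_max.

Definition homotopic (X Y : sSet) (f g : sMap X Y) : Prop :=
  exists H : sMap (sprod X (simplex 1)) Y,
    forall n (x : X n), H n (x, end0 n) = f n x /\ H n (x, end1 n) = g n x.

(* Between Kan complexes, homotopy equivalences are the equivalences of
   infinity-groupoids. *)
Definition homotopy_equivalence (X Y : sSet) (f : sMap X Y) : Prop :=
  exists g : sMap Y X, homotopic (smap_comp g f) (smap_id X) /\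
                       homotopic (smap_comp f g) (smap_id Y).

(* The internal hom from the interval. *)
Program Definition path_space (X : sSet) : sSet :=
  {| cell k := sMap (sprod (simplex k) (simplex 1)) X;
     sact j k a g := smap_comp g (sprod_map (simplex_map a) (smap_id _)) |}.
Next Obligation. by move=> X n x; apply: smap_ext => k [s t]. Qed.
Next Obligation. by move=> X l m n b a x; apply: smap_ext => k [s t]. Qed.

Program Definition path_end0 (X : sSet) : sMap (path_space X) X :=
  {| smap k (g : path_space X k) := g k (@idm Delta k, end0 k) |}.
Next Obligation. by move=> X j k a g; rewrite /= -smap_act. Qed.

Program Definition path_end1 (X : sSet) : sMap (path_space X) X :=
  {| smap k (g : path_space X k) := g k (@idm Delta k, end1 k) |}.
Next Obligation. by move=> X j k a g; rewrite /= -smap_act. Qed.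

Program Definition path_cst (X : sSet) : sMap X (path_space X) :=
  {| smap k (x : X k) :=
       {| smap j (st : sprod (simplex k) (simplex 1) j) := sact st.1 x |} |}.
Next Obligation. by move=> X k x i j a [s t]; rewrite /= -sact_comp. Qed.
Next Obligation.
by move=> X j k a x; apply: smap_ext => i [s t]; rewrite /= -sact_comp.
Qed.

(* The standard model X ×_Z Z^I ×_Z Y of the homotopy pullback of Kan
   complexes. *)
Record hpb_cell (X Y Z : sSet) (p : sMap X Z) (q : sMap Y Z) (k : nat) := {
  hpb_l : X k;
  hpb_r : Y k;
  hpb_path : path_space Z k;
  hpb_end0 : path_end0 Z k hpb_path = p k hpb_l;
  hpb_end1 : path_end1 Z k hpb_path = q k hpb_r }.

Lemma hpb_cell_ext (X Y Z : sSet) (p : sMap X Z) (q : sMap Y Z) k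
  (s t : hpb_cell p q k) :
  hpb_l s = hpb_l t -> hpb_r s = hpb_r t -> hpb_path s = hpb_path t -> s = t.
Proof.
case: s => a b c e f; case: t => a' b' c' e' f' /= aa bb cc; subst a' b' c'.
by rewrite (Prop_irrelevance e e') (Prop_irrelevance f f').
Qed.

Program Definition homotopy_pullback (X Y Z : sSet) (p : sMap X Z)
    (q : sMap Y Z) : sSet :=
  {| cell := hpb_cell p q;
     sact j k a s := {| hpb_l := sact a (hpb_l s);
                        hpb_r := sact a (hpb_r s);
                        hpb_path := sact a (hpb_path s) |} |}.
Next Obligation.
move=> X Y Z p q j k a s.
apply: (eq_trans (smap_act (path_end0 Z) a (hpb_path s))).
by rewrite hpb_end0 smap_act.
Qed.
Next Obligation.
move=> X Y Z p q j k a s.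
apply: (eq_trans (smap_act (path_end1 Z) a (hpb_path s))).
by rewrite hpb_end1 smap_act.
Qed.
Next Obligation. by move=> *; apply: hpb_cell_ext; exact: sact_id. Qed.
Next Obligation. by move=> *; apply: hpb_cell_ext; exact: sact_comp. Qed.

(* The comparison map of a commutative square
      W --v--> Y
      |u       |q
      v        v
      X --p--> Z  *)
Program Definition hpb_comparison (W X Y Z : sSet) (u : sMap W X) (v : sMap W Y)
    (p : sMap X Z) (q : sMap Y Z)
    (e : forall n (w : W n), p n (u n w) = q n (v n w)) :
    sMap W (homotopy_pullback p q) :=
  {| smap k (w : W k) :=
       ({| hpb_l := u k w; hpb_r := v k w;
           hpb_path := path_cst Z k (p k (u k w)) |}
        : homotopy_pullback p q k) |}.
Next Obligation. by move=> *; exact: sact_id. Qed.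
Next Obligation. by move=> W X Y Z u v p q e k w; rewrite -e; exact: sact_id. Qed.
Next Obligation.
move=> W X Y Z u v p q e j k a w; apply: hpb_cell_ext; rewrite /= ?smap_act //.
exact: (smap_act (path_cst Z)).
Qed.

Definition is_homotopy_pullback (W X Y Z : Space) (u : sMap W X) (v : sMap W Y)
    (p : sMap X Z) (q : sMap Y Z) : Prop :=
  exists e : (forall n (w : W n), p n (u n w) = q n (v n w)),
    homotopy_equivalence (hpb_comparison e).

(* Strict functors from the opposite of Delta to Kan complexes; every functor
   to the infinity-category of spaces has such a rectification. *)
Record SimplicialSpace := {
  level :> nat -> Space;
  lact : forall m n (a : @hom Delta m n), sMap (level n) (level m);
  lact_id : forall n k (x : level n k), lact (@idm Delta n) k x = x;
  lact_comp : forall l m n (b : @hom Delta m n) (a : @hom Delta l m) k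
      (x : level n k),
    lact (b ∘ a) k x = lact a k (lact b k x) }.

Arguments lact _ {m n} a.

(* As X is contravariant, the image of the pushout square has corner X n'. *)
Definition decomposition_space (X : SimplicialSpace) : Prop :=
  forall (m n m' n' : Delta) (g : hom m n) (f : hom m m')
      (f' : hom n n') (g' : hom m' n'),
    active g -> inert f -> is_pushout g f g' f' ->
    is_homotopy_pullback (lact X f') (lact X g') (lact X g) (lact X f).

Lemma ord_le_refl k : reflexive (fun i j : 'I_k => (i <= j)%O).
Proof. exact: lexx. Qed.

Lemma ord_le_trans k : transitive (fun i j : 'I_k => (i <= j)%O).
Proof. exact: le_trans. Qed.

Definition ord_cat (k : nat) : Category :=
  thin_cat (@ord_le_refl k.+1) (@ord_le_trans k.+1).

Program Definition ord_functor (m n : Delta) (a : hom m n) :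
    Functor (ord_cat m) (ord_cat n) :=
  {| fob (i : ord_cat m) := (a i : ord_cat n); fmap i j f := mfun_le a f |}.

Program Definition nerve_sset (G : Category) : sSet :=
  {| cell k := Functor (ord_cat k) G;
     sact j k a F := comp_functor F (ord_functor a) |}.
Next Obligation.
move=> G n F.
exact: (@functor_ext _ _ (comp_functor F (ord_functor (@idm Delta n))) F
         (fun=> erefl) (fun _ _ _ => erefl)).
Qed.
Next Obligation.
move=> G l m n b a F.
exact: (@functor_ext _ _ (comp_functor F (ord_functor (@comp Delta l m n b a)))
         (comp_functor (comp_functor F (ord_functor b)) (ord_functor a))
         (fun=> erefl) (fun _ _ _ => erefl)).
Qed.

Section NerveKan.
Variables (G : Groupoid) (n : nat) (k : 'I_n.+3).
Variable h : sMap (horn k) (nerve_sset G).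

Let misses v w := exists i : 'I_n.+3, [/\ i <> k, i <> v & i <> w].

Let misses_k v w : v = k \/ w = k -> misses v w.
Proof.
move=> vw; have [u uk] : exists u, (v = k \/ v = u) /\ (w = k \/ w = u).
  by case: vw => ->; [exists w | exists v]; split; auto.
have /card_gt0P[i] : 0 < #|~: [set k; u]|.
  rewrite cardsCs setCK card_ord cards2 subn_gt0.
  by case: (k != u).
rewrite !inE negb_or => /andP[/eqP ik /eqP iu].
by exists i; split => // E; subst i; case: uk => -[?|?] [?|?]; congruence.
Qed.

Let hmap j (t : horn k j) : Functor (ord_cat j) G := h j t.

Let vertex_sub (v : 'I_n.+3) :
  exists i, i <> k /\ forall a : 'I_1, mono_cst 'I_1 v a <> i.
Proof.
have [|i [ik iv _]] := @misses_k v k; first by right.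
by exists i; split => // _ /= E; apply: iv.
Qed.

Let vertex v : horn k 0 := exist _ (mono_cst 'I_1 v) (vertex_sub v).

Let x v : G := hmap (vertex v) ord0.

Let hmap_act i j (a : @hom Delta i j) (t : horn k j) :
  hmap (sact a t) = comp_functor (hmap t) (ord_functor a).
Proof. exact: (smap_act h). Qed.

Let hmap_ob j (t : horn k j) a : hmap t a = x (proj1_sig t a).
Proof.
rewrite /x; have -> : vertex (proj1_sig t a) = sact (mono_cst 'I_1 a) t.
  by apply: eq_exist; apply: mono_ext.
by rewrite hmap_act.
Qed.

Let val_arr j (t : horn k j) (a b : 'I_j.+1) (le : (a <= b)%O) :
    hom (x (proj1_sig t a)) (x (proj1_sig t b)) :=
  hcast (hmap_ob t a) (hmap_ob t b) (@fmap _ _ (hmap t) a b le).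

Let hcast_comp (C : Category) (u v w u' v' w' : C) (p : u = u') (q : v = v')
  (r : w = w') (g : hom v w) (f : hom u v) :
  hcast p r (g ∘ f) = hcast q r g ∘ hcast p q f.
Proof. by subst. Qed.

Let val_comp j (t : horn k j) a b c (ab : (a <= b)%O) (bc : (b <= c)%O)
  (ac : (a <= c)%O) : val_arr t ac = val_arr t bc ∘ val_arr t ab.
Proof.
rewrite /val_arr -hcast_comp; congr (hcast _ _ _); rewrite -fmap_comp.
by congr (fmap _ _); exact: bool_irrelevance.
Qed.

Let val_act i j (a : @hom Delta i j) (t : horn k j) (s : horn k i) u v
  (le : (u <= v)%O) p q :
  s = sact a t -> hcast p q (val_arr s le) = val_arr t (mfun_le a le).
Proof.
move=> E; subst s; rewrite hcast_id /val_arr.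
move: (hmap_ob _ _) (hmap_ob _ _); rewrite hmap_act => p' q'.
by rewrite /=; congr (hcast _ _ _); exact: Prop_irrelevance.
Qed.

Let edge_fun d (I : orderType d) (v w : I) (i : 'I_2) :=
  if i == ord0 then v else w.

Let edge_le d (I : orderType d) (v w : I) : (v <= w)%O ->
  forall i j : 'I_2, (i <= j)%O -> (edge_fun v w i <= edge_fun v w j)%O.
Proof.
move=> vw [[|[|i]] Hi] // [[|[|j]] Hj] // _; exact: lexx.
Qed.

Let edge_map d (I : orderType d) (v w : I) (vw : (v <= w)%O) : MonoMap 'I_2 I :=
  {| mfun := edge_fun v w; mfun_le := edge_le vw |}.

Let edge_sub v w (vw : (v <= w)%O) : misses v w ->
  exists i, i <> k /\ forall a, edge_map vw a <> i.
Proof.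
case=> i [ik iv iw]; exists i; split => // a /=; rewrite /edge_fun.
by case: ifP => _ E; [apply: iv|apply: iw].
Qed.

Let edge v w (vw : (v <= w)%O) (m : misses v w) : horn k 1 :=
  exist _ (edge_map vw) (edge_sub vw m).

Let le01 : ((ord0 : 'I_2) <= ord_max)%O := isT.

Let e v w (vw : (v <= w)%O) (m : misses v w) : hom (x v) (x w) :=
  val_arr (edge vw m) le01.

Let val_e j (t : horn k j) a b (ab : (a <= b)%O) m :
  val_arr t ab = e (mfun_le (proj1_sig t) ab) m.
Proof.
have E : edge (mfun_le (proj1_sig t) ab) m = sact (edge_map ab) t.
  apply: eq_exist; apply: mono_ext => i /=; rewrite /edge_fun.
  by case: ifP.
have := @val_act _ _ (edge_map ab) t (edge (mfun_le (proj1_sig t) ab) m)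
  ord0 ord_max le01 erefl erefl E.
rewrite /e /= => ->.
by rewrite (bool_irrelevance (edge_le ab le01) ab).
Qed.

Let tri_fun (u v w : 'I_n.+3) (i : 'I_3) :=
  if i == ord0 then u else if i == ord_max then w else v.

Let e_comp u v w (uv : (u <= v)%O) (vw : (v <= w)%O) (uw : (u <= w)%O) muv mvw muw :
  (exists i, [/\ i <> k, i <> u, i <> v & i <> w]) ->
  e uw muw = e vw mvw ∘ e uv muv.
Proof.
case=> i [ik iu iv iw].
have tP : forall a b : 'I_3, (a <= b)%O -> (tri_fun u v w a <= tri_fun u v w b)%O.
  by move=> [[|[|[|a]]] Ha] // [[|[|[|b]]] Hb] // _; exact: lexx.
pose t0 : @hom Delta 2 n.+2 := {| mfun := tri_fun u v w; mfun_le := tP |}.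
have tS : exists i, i <> k /\ forall a, t0 a <> i.
  exists i; split => // a /=; rewrite /tri_fun.
  by case: ifP => _; [|case: ifP => _] => E; [apply: iu|apply: iw|apply: iv].
pose t : horn k 2 := exist _ t0 tS.
pose o1 : 'I_3 := Ordinal (isT : 1 < 3).
have l01 : ((ord0 : 'I_3) <= o1)%O by [].
have l12 : (o1 <= (ord_max : 'I_3))%O by [].
have l02 : ((ord0 : 'I_3) <= ord_max)%O by [].
have := val_comp t l01 l12 l02.
rewrite (@val_e _ t _ _ l01 muv) (@val_e _ t _ _ l12 mvw) (@val_e _ t _ _ l02 muw).
rewrite (bool_irrelevance (mfun_le t0 l01) uv).
rewrite (bool_irrelevance (mfun_le t0 l12) vw).
by rewrite (bool_irrelevance (mfun_le t0 l02) uw).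
Qed.

Let spoke_dec (v : 'I_n.+3) : {(k <= v)%O} + {(v < k)%O}.
Proof. by case: (leP k v) => ?; [left|right]. Qed.

Let spoke v : hom (x k) (x v) :=
  match spoke_dec v with
  | left kv => e kv (@misses_k k v (or_introl erefl))
  | right vk => ginv (e (ltW vk) (@misses_k v k (or_intror erefl)))
  end.

Let e_spoke v w (vw : (v <= w)%O) m : e vw m ∘ spoke v = spoke w.
Proof.
rewrite /spoke; have [i [ik iv iw]] := m.
case: (spoke_dec v) => [kv|vk]; case: (spoke_dec w) => [kw|wk].
- by rewrite -(@e_comp k v w kv vw kw _ m (@misses_k k w (or_introl erefl))) //; exists i.
- by have := le_lt_trans (le_trans kv vw) wk; rewrite ltxx.
- rewrite (@e_comp v k w (ltW vk) kw vw (@misses_k v k (or_intror erefl))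
    (@misses_k k w (or_introl erefl))); last by exists i.
  by rewrite -comp_assoc ginvr comp_idr.
- rewrite (@e_comp v w k vw (ltW wk) (ltW vk) m (@misses_k w k (or_intror erefl)));
    last by exists i.
  set f := e (ltW wk) _; set g := e vw m.
  rewrite -[LHS]comp_idl -(ginvl f) -comp_assoc (comp_assoc f) ginvr comp_idr.
  by [].
Qed.

Let filler : Functor (ord_cat n.+2) G.
Proof.
refine {| fob (v : ord_cat n.+2) := x v;
          fmap v w (_ : @hom (ord_cat n.+2) v w) := spoke w ∘ ginv (spoke v) |}.
- by move=> v; rewrite ginvr.
- move=> u v w _ _.
  by rewrite -comp_assoc (comp_assoc (ginv (spoke v))) ginvl comp_idl.
Defined.

Let filler_horn j (t : horn k j) :
  h j t = comp_functor filler (ord_functor (proj1_sig t)).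
Proof.
apply: (@functor_ext _ _ (h j t)
  (comp_functor filler (ord_functor (proj1_sig t))) (hmap_ob t)) => a b ab /=.
have m : misses (proj1_sig t a) (proj1_sig t b).
  have [i [ik it]] := proj2_sig t.
  by exists i; split => // E; [apply: (it a)|apply: (it b)].
rewrite -[LHS]/(val_arr t ab) (val_e ab m) -(e_spoke (mfun_le (proj1_sig t) ab) m).
by rewrite -comp_assoc ginvr comp_idr.
Qed.

Lemma nerve_horn_filler :
  exists f : nerve_sset G n.+2,
    forall j (t : horn k j), h j t = sact (proj1_sig t) f.
Proof. by exists filler => j t; apply: filler_horn. Qed.

End NerveKan.

Lemma nerve_kan (G : Groupoid) : is_kan (nerve_sset G).
Proof.
move=> [|n] k h; last exact: nerve_horn_filler.
have vk : exists i : 'I_2, i <> k /\ forall a : 'I_1, mono_cst 'I_1 k a <> i.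
  case: k {h} => [[|[|k]] Hk] //; [exists ord_max|exists ord0].
    by split => // /(congr1 val).
  by split => // /(congr1 val).
pose v : horn k 0 := exist _ (mono_cst 'I_1 k) vk.
exists (sact (mono_cst 'I_2 (ord0 : 'I_1) : @hom Delta 1 0) (h 0 v)) => j t.
rewrite -sact_comp -smap_act; congr (h j _).
case: t => t tP; apply: eq_exist; apply: mono_ext => a /=.
have [i [ik it]] := tP; apply/val_inj; move: (it a) ik; move: (t a) => b.
have ne (c c' : 'I_2) : c <> c' -> val c <> val c' by move=> cc /val_inj.
move=> /ne bi /ne ik; move: (ltn_ord b) (ltn_ord k) (ltn_ord i) bi ik => /=.
by case: (val b) (val k) (val i) => [|[|?]] [|[|?]] [|[|?]].
Qed.

(* Groupoids are regarded as infinity-groupoids through the nerve. *)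
Definition nerve (G : Groupoid) : Space :=
  {| space_sset := nerve_sset G; space_kan := @nerve_kan G |}.

Definition nerve_map (G H : Groupoid) (F : Functor G H) :
    sMap (nerve G) (nerve H).
Proof.
refine {| smap k (x : nerve G k) := (comp_functor F x : nerve H k) |}.
move=> m n a x.
exact: (@functor_ext _ _ (comp_functor F (comp_functor x (ord_functor a)))
  (comp_functor (comp_functor F x) (ord_functor a))
  (fun=> erefl) (fun _ _ _ => erefl)).
Defined.

Record Preadditive := {
  pcat :> Category;
  hadd : forall x y : pcat, hom x y -> hom x y -> hom x y;
  hzero : forall x y : pcat, hom x y;
  hopp : forall x y : pcat, hom x y -> hom x y;
  haddA : forall (x y : pcat) (f g h : hom x y),
    hadd f (hadd g h) = hadd (hadd f g) h;
  haddC : forall (x y : pcat) (f g : hom x y), hadd f g = hadd g f;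
  hadd0 : forall (x y : pcat) (f : hom x y), hadd (hzero x y) f = f;
  haddN : forall (x y : pcat) (f : hom x y), hadd (hopp f) f = hzero x y;
  comp_addl : forall (x y z : pcat) (g g' : hom y z) (f : hom x y),
    hadd g g' ∘ f = hadd (g ∘ f) (g' ∘ f);
  comp_addr : forall (x y z : pcat) (g : hom y z) (f f' : hom x y),
    g ∘ hadd f f' = hadd (g ∘ f) (g ∘ f') }.

Section PreadditiveNotions.
Variable A : Preadditive.

Definition is_kernel (k x y : A) (i : hom k x) (f : hom x y) : Prop :=
  f ∘ i = hzero k y /\
  forall w (u : hom w x), f ∘ u = hzero w y -> exists! v : hom w k, i ∘ v = u.

Definition is_cokernel (x y c : A) (p : hom y c) (f : hom x y) : Prop :=
  p ∘ f = hzero x c /\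
  forall z (u : hom y z), u ∘ f = hzero x z -> exists! v : hom c z, v ∘ p = u.

Definition is_biproduct (x y s : A) (i1 : hom x s) (i2 : hom y s)
    (p1 : hom s x) (p2 : hom s y) : Prop :=
  [/\ p1 ∘ i1 = idm x, p2 ∘ i2 = idm y, p2 ∘ i1 = hzero x y,
      p1 ∘ i2 = hzero y x & hadd (i1 ∘ p1) (i2 ∘ p2) = idm s].

End PreadditiveNotions.

Record AbelianCategory := {
  acat :> Preadditive;
  has_zero_object : exists z : acat, is_zero_object z;
  has_biproducts : forall x y : acat,
    exists (s : acat) (i1 : hom x s) (i2 : hom y s) (p1 : hom s x) (p2 : hom s y),
      is_biproduct i1 i2 p1 p2;
  has_kernels : forall (x y : acat) (f : hom x y),
    exists (k : acat) (i : hom k x), is_kernel i f;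
  has_cokernels : forall (x y : acat) (f : hom x y),
    exists (c : acat) (p : hom y c), is_cokernel p f;
  mono_is_kernel : forall (x y : acat) (f : hom x y), is_mono f ->
    exists (z : acat) (g : hom y z), is_kernel f g;
  epi_is_cokernel : forall (x y : acat) (f : hom x y), is_epi f ->
    exists (w : acat) (g : hom w x), is_cokernel f g }.

Record ArOb d (I : orderType d) := {
  ar_src : I;
  ar_tgt : I;
  ar_le : (ar_src <= ar_tgt)%O }.

Definition ar_rel d (I : orderType d) : rel (ArOb I) :=
  fun x y => (ar_src x <= ar_src y)%O && (ar_tgt x <= ar_tgt y)%O.

Lemma ar_rel_refl d (I : orderType d) : reflexive (@ar_rel d I).
Proof. by move=> x; rewrite /ar_rel !lexx. Qed.

Lemma ar_rel_trans d (I : orderType d) : transitive (@ar_rel d I).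
Proof.
move=> y x z /andP[h1 h2] /andP[h3 h4].
by rewrite /ar_rel (le_trans h1 h3) (le_trans h2 h4).
Qed.

Definition Ar d (I : orderType d) : Category :=
  thin_cat (@ar_rel_refl d I) (@ar_rel_trans d I).

Definition ar d (I : orderType d) (i j : I) (ij : (i <= j)%O) : Ar I :=
  {| ar_src := i; ar_tgt := j; ar_le := ij |}.

Definition ar_hom d (I : orderType d) (i j i' j' : I) (ij : (i <= j)%O)
    (ij' : (i' <= j')%O) (ii : (i <= i')%O) (jj : (j <= j')%O) :
    hom (ar ij) (ar ij') :=
  introT andP (conj ii jj).

(*  F(i,j) --> F(i,k)
      |          |
      v          v
    F(j,j) --> F(j,k)  *)
Definition is_gap (A : Category) d (I : orderType d) (F : Functor (Ar I) A) : Prop :=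
  (forall i, is_zero_object (F (ar (lexx i)))) /\
  forall (i j k : I) (ij : (i <= j)%O) (jk : (j <= k)%O) (ik : (i <= k)%O),
    let top   := fmap F (ar_hom ij ik (lexx i) jk) in
    let left  := fmap F (ar_hom ij (lexx j) ij (lexx j)) in
    let right := fmap F (ar_hom ik jk ij (lexx k)) in
    let bot   := fmap F (ar_hom (lexx j) jk (lexx j) jk) in
    [/\ is_mono top, is_mono bot, is_epi left, is_epi right
      & is_pushout top left bot right].

Definition Gap d (I : orderType d) (A : Category) : Category :=
  @full_subcat (functor_cat (Ar I) A) (@is_gap A d I).

Lemma is_gap_square (A : Category) d (I : orderType d) (F : Functor (Ar I) A) :
  is_gap F -> forall (i j k : I)
    (ij : (i <= j)%O) (jk : (j <= k)%O) (ik : (i <= k)%O) (jj : (j <= j)%O)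
    (t : hom (ar ij) (ar ik)) (l : hom (ar ij) (ar jj))
    (r : hom (ar ik) (ar jk)) (b : hom (ar jj) (ar jk)),
  [/\ is_mono (fmap F t), is_mono (fmap F b), is_epi (fmap F l),
      is_epi (fmap F r) & is_pushout (fmap F t) (fmap F l) (fmap F b) (fmap F r)].
Proof.
case=> _ F1 i j k ij jk ik jj.
rewrite (bool_irrelevance jj (lexx j)) => t l r b.
rewrite (bool_irrelevance t (ar_hom ij ik (lexx i) jk)).
rewrite (bool_irrelevance l (ar_hom ij (lexx j) ij (lexx j))).
rewrite (bool_irrelevance r (ar_hom ik jk ij (lexx k))).
rewrite (bool_irrelevance b (ar_hom (lexx j) jk (lexx j) jk)).
exact: F1.
Qed.

Program Definition ar_functor d (I : orderType d) d' (J : orderType d')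
    (a : MonoMap I J) : Functor (Ar I) (Ar J) :=
  {| fob (x : Ar I) := ar (mfun_le a (ar_le x));
     fmap x y f := introT andP (conj (mfun_le a (proj1 (elimT andP f)))
                                     (mfun_le a (proj2 (elimT andP f)))) |}.

Lemma gap_restrict d (I : orderType d) d' (J : orderType d') (A : Category)
  (a : MonoMap I J) (F : Functor (Ar J) A) :
  is_gap F -> is_gap (comp_functor F (ar_functor a)).
Proof.
move=> FP; split=> [i|i j k ij jk ik]; last exact: is_gap_square FP _ _ _ _ _ _ _ _ _ _ _.
rewrite /= (bool_irrelevance (mfun_le a (lexx i)) (lexx (a i))).
by case: FP.
Qed.

Program Definition gap_functor d (I : orderType d) d' (J : orderType d')
    (A : Category) (a : MonoMap I J) : Functor (Gap J A) (Gap I A) :=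
  {| fob F := exist _ (comp_functor (proj1_sig F) (ar_functor a))
                      (gap_restrict a (proj2_sig F)) : Gap I A;
     fmap F G s := {| nt x := s (ar_functor a x) |} |}.
Next Obligation. by move=> *; exact: nt_natural. Qed.
Next Obligation. by move=> *; apply: nt_ext. Qed.
Next Obligation. by move=> *; apply: nt_ext. Qed.

Definition waldhausen_level (A : Category) (n : Delta) : Space :=
  nerve (core (Gap 'I_n.+1 A)).

Definition waldhausen_act (A : Category) (m n : Delta) (a : hom m n) :
    sMap (waldhausen_level A n) (waldhausen_level A m) :=
  nerve_map (core_functor (gap_functor A a)).

Lemma gap_diagram_ext (K A : Category) d (I : orderType d)
  (c c' : Functor K (core (Gap I A))) (e : forall i, c i = c' i) :
  (forall i j (f : hom i j) x p q,
     hcast p q (nt (iso_hom (fmap c f)) x) = nt (iso_hom (fmap c' f)) x) ->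
  c = c'.
Proof.
move=> cc'; apply: (@functor_ext _ _ c c' e) => i j f.
apply: iso_ext; apply: nt_ext => x.
have eq_at (F F' : core (Gap I A)) : F = F' -> proj1_sig F x = proj1_sig F' x :> A.
  by move=> ->.
have key (F F' G G' : core (Gap I A)) (P : F = F') (Q : G = G') (s : hom F G) p q :
    nt (iso_hom (hcast P Q s)) x = hcast p q (nt (iso_hom s) x).
  by subst F' G'; rewrite !hcast_id.
by rewrite -(cc' i j f x (eq_at _ _ (e i)) (eq_at _ _ (e j))); apply: key.
Qed.

Lemma gap_eq (A : Category) d (I : orderType d) (F G : Gap I A) :
  proj1_sig F = proj1_sig G -> F = G.
Proof. by case: F => F FP; case: G => G GP; apply: eq_exist. Qed.

Lemma waldhausen_act_id (A : Category) (n k : nat) (c : waldhausen_level A n k) :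
  waldhausen_act A (@idm Delta n) k c = c.
Proof.
apply: gap_diagram_ext => [i|i j f x p q].
  rewrite /=; apply: gap_eq; set F := proj1_sig (c i).
  apply: (@functor_ext _ _ (comp_functor F (ar_functor (@idm Delta n))) F
            (fun=> erefl)) => x y f /=.
  by congr (fmap _ _); exact: bool_irrelevance.
by rewrite hcast_id.
Qed.

Lemma waldhausen_act_comp (A : Category) (l m n : Delta) (b : hom m n)
  (a : hom l m) k (c : waldhausen_level A n k) :
  waldhausen_act A (b ∘ a) k c = waldhausen_act A a k (waldhausen_act A b k c).
Proof.
apply: gap_diagram_ext => [i|i j f x p q].
  rewrite /=; apply: gap_eq; set F := proj1_sig (c i).
  apply: (@functor_ext _ _ (comp_functor F (ar_functor (mono_comp b a)))
            (comp_functor (comp_functor F (ar_functor b)) (ar_functor a))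
            (fun=> erefl)) => x y f /=.
  by congr (fmap _ _); exact: bool_irrelevance.
by rewrite hcast_id.
Qed.

Definition waldhausen (A : Category) : SimplicialSpace :=
  {| level := waldhausen_level A;
     lact := @waldhausen_act A;
     lact_id := @waldhausen_act_id A;
     lact_comp := @waldhausen_act_comp A |}.

(* Main.v *)
(* A homotopy pullback of nerves of groupoids is the nerve of the iso-comma
   groupoid, so it suffices that the functor from gap complexes on [n'] to
   triples (gap complex on [n], gap complex on [m'], isomorphism over [m]) is
   fully faithful and essentially surjective.

   A gap complex [F] on a linear order with least element [lo] and greatest
   element [hi] is the complex of quotients of the filtration of [F(lo, hi)] by
   the [F(lo, j)], and maps of gap complexes are filtered maps of the ambient
   objects.  Given [F] on [n] and [G] on [m'], the filtration of the top object
   [G(0, m')] by the [G(0, i)] is refined between the two steps bounding the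
   image of [m] by the inverse images of the [F(0, k)], along the epimorphism
   onto [G(f 0, f m)], which is isomorphic to [F(g 0, g m) = F(0, n)] as [g] is
   active; the quotients of the refined filtration form the glued complex. *)
Set Warnings "-notation-overridden".
From mathcomp Require Import all_boot all_order.
From mathcomp Require Import boolp.
Require Import Defs.

Set Implicit Arguments.
Unset Strict Implicit.
Unset Printing Implicit Defensive.
Set Primitive Projections.

Import Order.TTheory.

#[local] Obligation Tactic := simpl; try by [].

(** Assembling a functor on [Ar [n']] from [F] and [G] directly would require a value at each pair
    with one index from either side, and coherence for every kind of pair. Filtrations avoid this:
    they depend on one index only, so gluing becomes the extension of a monotone map from [[n']] to
    the preorder of subobjects of a single object. The isomorphism over [[m]] is absorbed when the
    filtration of [F] is pulled back into the top object of [G]; afterwards the two filtrations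
    agree over [[m]] up to mutual inclusion. Diagram chases replace elements by maps out of epic
    covers, through [epi_lift]. The square of groupoids attached to a pushout commutes strictly, by
    an equality of functors. The transports that this causes are turned into values of gap complexes
    on arrows of the poset [Ar]. *)

(** * Homotopy pullbacks of nerves *)

(* As [D] is a groupoid, the cylinder of [s] can be defined by conjugating [F]
   by [id] or [s]: no case analysis on edges of the interval is needed. *)
Section Cylinder.
Variables (C : Category) (D : Groupoid) (F G : Functor C D) (s : NatTrans F G).

Definition cyl_ob (b : nat) (x : C) : D := if b is 0 then F x else G x.

Definition cyl_leg (b : nat) (x : C) : hom (F x) (cyl_ob b x) :=
  if b is 0 then idm (F x) else s x.

Program Definition cylinder (k : nat) (c : Functor (ord_cat k) C)
    (t : simplex 1 k) : Functor (ord_cat k) D :=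
  {| fob a := cyl_ob (t a) (c a);
     fmap a b ab := cyl_leg (t b) (c b) ∘ fmap F (fmap c ab)
                      ∘ ginv (cyl_leg (t a) (c a)) |}.
Next Obligation. by move=> k c t a; rewrite !fmap_id comp_idr ginvr. Qed.
Next Obligation.
move=> k c t x y z g f; rewrite !fmap_comp -!comp_assoc.
by rewrite (comp_assoc (ginv _) (cyl_leg _ _)) ginvl comp_idl.
Qed.

Definition cylinder_map : sMap (sprod (nerve_sset C) (simplex 1)) (nerve_sset D).
Proof.
refine {| smap k (x : sprod (nerve_sset C) (simplex 1) k) :=
            (cylinder x.1 x.2 : nerve_sset D k) |}.
move=> m n a x.
exact: (@functor_ext _ _ (cylinder (sact a x).1 (sact a x).2)
  (comp_functor (cylinder x.1 x.2) (ord_functor a)) (fun=> erefl)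
  (fun _ _ _ => erefl)).
Defined.

Lemma cylinder_end0 k (c : Functor (ord_cat k) C) :
  cylinder c (end0 k) = comp_functor F c.
Proof.
apply: (@functor_ext _ _ (cylinder c (end0 k)) (comp_functor F c) (fun=> erefl)).
by move=> a b ab /=; rewrite -[ginv _]comp_idr ginvl comp_idl comp_idr.
Qed.

Lemma cylinder_end1 k (c : Functor (ord_cat k) C) :
  cylinder c (end1 k) = comp_functor G c.
Proof.
apply: (@functor_ext _ _ (cylinder c (end1 k)) (comp_functor G c) (fun=> erefl)).
by move=> a b ab /=; rewrite nt_natural -comp_assoc ginvr comp_idr.
Qed.

End Cylinder.

Lemma nerve_map_homotopic (C D : Groupoid) (F G : Functor C D) :
  NatTrans F G -> homotopic (nerve_map F) (nerve_map G).
Proof.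
move=> s; exists (cylinder_map s) => n c; split.
  exact: (cylinder_end0 s c).
exact: (cylinder_end1 s c).
Qed.

Definition edge_map d (I : orderType d) (v w : I) (vw : (v <= w)%O) :
  MonoMap 'I_2 I.
Proof.
refine {| mfun (i : 'I_2) := if val i is 0 then v else w |}.
by move=> [[|[|i]] Hi] // [[|[|j]] Hj].
Defined.

Definition triangle_map d (I : orderType d) (u v w : I) (uv : (u <= v)%O)
  (vw : (v <= w)%O) : MonoMap 'I_3 I.
Proof.
refine {| mfun (i : 'I_3) :=
            match val i with 0 => u | 1 => v | _ => w end |}.
by move=> [[|[|[|i]]] Hi] // [[|[|[|j]]] Hj] //= _; apply: le_trans vw.
Defined.

Lemma hcast_comp (C : Category) (u v w u' v' w' : C) (p : u = u') (q : v = v')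
  (r : w = w') (g : hom v w) (f : hom u v) :
  hcast p r (g ∘ f) = hcast q r g ∘ hcast p q f.
Proof. by subst. Qed.

Lemma hcastK (C : Category) (x x' y y' : C) (p : x = x') (q : y = y') p' q'
  (f : hom x y) : hcast p' q' (hcast p q f) = f.
Proof. by subst; rewrite hcast_id. Qed.

Lemma hcast_trans (C : Category) (x x' x'' y y' y'' : C) (p : x = x') (q : y = y')
  (p' : x' = x'') (q' : y' = y'') (f : hom x y) :
  hcast p' q' (hcast p q f) = hcast (etrans p p') (etrans q q') f.
Proof. by subst. Qed.

Lemma hcast_irr (C : Category) (x x' y y' : C) (p p' : x = x') (q q' : y = y')
  (f : hom x y) : hcast p q f = hcast p' q' f.
Proof. by rewrite (Prop_irrelevance p p') (Prop_irrelevance q q'). Qed.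

(** * Cells of the path space of a nerve as natural transformations *)

Section Path.
Variables (Z : Groupoid) (k : nat).
Variable path : sMap (sprod (simplex k) (simplex 1)) (nerve_sset Z).

Let cell j (s : simplex k j) (t : simplex 1 j) : Functor (ord_cat j) Z :=
  path j (s, t).

Let le01 : ((ord0 : 'I_2) <= ord_max)%O := isT.

(** The vertices of the prism [[k] x [1]]; with [path_arr] for its edges they serve as a normal
    form, to which the values of all cells are compared by [hcast]. *)
Definition path_ob (i : 'I_k.+1) (b : 'I_2) : Z :=
  cell (mono_cst 'I_1 i) (mono_cst 'I_1 b) ord0.

Lemma cell_act i j (a : @hom Delta i j) (s : simplex k j) (t : simplex 1 j) :
  cell (sact a s) (sact a t) = comp_functor (cell s t) (ord_functor a).
Proof. exact: (smap_act path a (s, t)). Qed.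

Lemma cell_ob j (s : simplex k j) (t : simplex 1 j) a :
  cell s t a = path_ob (s a) (t a).
Proof.
have -> : path_ob (s a) (t a) =
    cell (sact (mono_cst 'I_1 a) s) (sact (mono_cst 'I_1 a) t) ord0.
  by congr (cell _ _ _); apply: mono_ext.
by rewrite cell_act.
Qed.

Let arr j (s : simplex k j) (t : simplex 1 j) (a b : 'I_j.+1) (ab : (a <= b)%O) :
    hom (path_ob (s a) (t a)) (path_ob (s b) (t b)) :=
  hcast (cell_ob s t a) (cell_ob s t b) (@fmap _ _ (cell s t) a b ab).

Lemma arr_act i j (c : @hom Delta i j) (s : simplex k j) (t : simplex 1 j)
    (a b : 'I_i.+1) (ab : (a <= b)%O) :
  arr (sact c s) (sact c t) ab = arr s t (mfun_le c ab).
Proof.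
rewrite /arr; move: (cell_ob _ _ _) (cell_ob _ _ _); rewrite cell_act => p q.
by exact: hcast_irr.
Qed.

Definition path_arr (i i' : 'I_k.+1) (b b' : 'I_2) (ii : (i <= i')%O)
    (bb : (b <= b')%O) : hom (path_ob i b) (path_ob i' b') :=
  arr (edge_map ii) (edge_map bb) le01.

Lemma arr_congr j (s s' : simplex k j) (t t' : simplex 1 j) a b
    (ab : (a <= b)%O) p q :
  s = s' -> t = t' -> hcast p q (arr s t ab) = arr s' t' ab.
Proof. by move=> ss tt; subst s' t'; rewrite hcast_id. Qed.

(** Naturality of [path] restricts the cell to the edge from [a] to [b]. The restricted maps agree
    with [edge_map] only pointwise, hence the detour through [arr_congr]. *)
Lemma arrE j (s : simplex k j) (t : simplex 1 j) a b (ab : (a <= b)%O) :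
  arr s t ab = path_arr (mfun_le s ab) (mfun_le t ab).
Proof.
have := @arr_congr _ (sact (edge_map ab) s) (edge_map (mfun_le s ab))
  (sact (edge_map ab) t) (edge_map (mfun_le t ab)) _ _ le01 erefl erefl.
rewrite /path_arr => <-; first last.
- by apply: mono_ext => /= i; case: (val i).
- by apply: mono_ext => /= i; case: (val i).
rewrite /= arr_act; congr (arr _ _ _); exact: bool_irrelevance.
Qed.

(** All three edges lie in one 2-simplex of the prism, and the image of that simplex is a
    functor. *)
Lemma path_arr_comp i i' i'' b b' b'' (ii : (i <= i')%O) (ii' : (i' <= i'')%O)
    (bb : (b <= b')%O) (bb' : (b' <= b'')%O) (ii'' : (i <= i'')%O)
    (bb'' : (b <= b'')%O) :
  path_arr ii' bb' ∘ path_arr ii bb = path_arr ii'' bb''.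
Proof.
pose o1 : 'I_3 := Ordinal (isT : 1 < 3).
have l01 : ((ord0 : 'I_3) <= o1)%O by [].
have l12 : (o1 <= (ord_max : 'I_3))%O by [].
have l02 : ((ord0 : 'I_3) <= ord_max)%O by [].
pose s : simplex k 2 := triangle_map ii ii'.
pose t : simplex 1 2 := triangle_map bb bb'.
have E1 := arrE s t l01; have E2 := arrE s t l12; have E3 := arrE s t l02.
rewrite (bool_irrelevance (mfun_le s l01) ii) in E1.
rewrite (bool_irrelevance (mfun_le t l01) bb) in E1.
rewrite (bool_irrelevance (mfun_le s l12) ii') in E2.
rewrite (bool_irrelevance (mfun_le t l12) bb') in E2.
rewrite (bool_irrelevance (mfun_le s l02) ii'') in E3.
rewrite (bool_irrelevance (mfun_le t l02) bb'') in E3.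
rewrite -E1 -E2 -E3 /arr -hcast_comp -fmap_comp.
by congr (hcast _ _ (fmap _ _)); exact: bool_irrelevance.
Qed.

Section PathNt.
Variables (M N : Functor (ord_cat k) Z).
Hypothesis path0 : path k (@idm Delta k, end0 k) = M.
Hypothesis path1 : path k (@idm Delta k, end1 k) = N.

Lemma path_ob0 i : path_ob i ord0 = M i.
Proof. by rewrite -path0 [RHS](cell_ob (@idm Delta k) (end0 k)). Qed.

Lemma path_ob1 i : path_ob i ord_max = N i.
Proof. by rewrite -path1 [RHS](cell_ob (@idm Delta k) (end1 k)). Qed.

Lemma path_arr0 i i' (ii : (i <= i')%O) bb p q :
  hcast p q (path_arr ii bb : hom (path_ob i ord0) (path_ob i' ord0)) =
  @fmap _ _ M i i' ii.
Proof.
move: p q; rewrite -path0 => p q.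
have E : @arr k (@idm Delta k) (end0 k) i i' ii = path_arr ii bb.
  by rewrite arrE; congr path_arr; exact: bool_irrelevance.
by rewrite -E hcastK.
Qed.

Lemma path_arr1 i i' (ii : (i <= i')%O) bb p q :
  hcast p q (path_arr ii bb : hom (path_ob i ord_max) (path_ob i' ord_max)) =
  @fmap _ _ N i i' ii.
Proof.
move: p q; rewrite -path1 => p q.
have E : @arr k (@idm Delta k) (end1 k) i i' ii = path_arr ii bb.
  by rewrite arrE; congr path_arr; exact: bool_irrelevance.
by rewrite -E hcastK.
Qed.

Definition path_nt : NatTrans M N.
Proof.
refine {| nt (i : ord_cat k) :=
            hcast (path_ob0 i) (path_ob1 i) (path_arr (lexx (i : 'I_k.+1)) le01) |}.
move=> i j ij.
rewrite -(path_arr0 ij (lexx _) (path_ob0 i) (path_ob0 j)).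
rewrite -(path_arr1 ij (lexx _) (path_ob1 i) (path_ob1 j)).
(* Both ways around the naturality square equal the diagonal edge from [(i, 0)] to [(j, 1)]. *)
by rewrite -!hcast_comp !(path_arr_comp _ _ _ _ ij le01).
Defined.

Lemma path_cyl_ob i (b : 'I_2) : path_ob i b = cyl_ob M N b i.
Proof.
case: b => [[|[|b]] Hb] //=.
  by rewrite -path_ob0; congr path_ob; apply: val_inj.
by rewrite -path_ob1; congr path_ob; apply: val_inj.
Qed.

(** The defining formula of [cylinder] on edges, with the inverse leg moved to the other side. The
    case of an edge from 1 to 0 is excluded by [bb]. *)
Lemma path_arr_leg i i' b b' (ii : (i <= i')%O) (bb : (b <= b')%O) p q :
  hcast p q (path_arr ii bb) ∘ cyl_leg path_nt b i =
  cyl_leg path_nt b' i' ∘ fmap M (ii : @hom (ord_cat k) i i').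
Proof.
have b01 (c : 'I_2) : c = ord0 \/ c = ord_max.
  by case: c => [[|[|c]] Hc] //; [left|right]; apply: val_inj.
case: (b01 b) (b01 b') => ? [?|?]; subst b b'; move: p q => /= p q //.
- by rewrite comp_idl comp_idr path_arr0.
- rewrite comp_idr -(path_arr0 ii (lexx _) p (path_ob0 i')) -hcast_comp.
  rewrite (path_arr_comp _ _ _ _ ii bb).
  by exact: hcast_irr.
- have := nt_natural path_nt (ii : @hom (ord_cat k) i i') => /= ->.
  by rewrite path_arr1.
Qed.

(** A simplex of a nerve is determined by its edges, and [path_arr_leg] recovers every edge of the
    prism from the vertical ones and the bottom. *)
Lemma path_cylinder j (s : simplex k j) (t : simplex 1 j) :
  path j (s, t) = cylinder path_nt (ord_functor s) t.
Proof.
apply: (@functor_ext _ _ (cell s t) (cylinder path_nt (ord_functor s) t)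
  (fun a => etrans (cell_ob s t a) (path_cyl_ob (s a) (t a)))) => a b ab /=.
have pq := path_arr_leg (mfun_le s ab) (mfun_le t ab) (path_cyl_ob _ _)
  (path_cyl_ob _ _).
rewrite -pq -comp_assoc ginvr comp_idr -arrE.
by rewrite /arr hcast_trans; exact: hcast_irr.
Qed.

End PathNt.
End Path.

Lemma path_nt_act (Z : Groupoid) j k (a : @hom Delta j k)
    (path : sMap (sprod (simplex k) (simplex 1)) (nerve_sset Z))
    (M N : Functor (ord_cat k) Z) (M' N' : Functor (ord_cat j) Z)
    (path0 : path k (@idm Delta k, end0 k) = M)
    (path1 : path k (@idm Delta k, end1 k) = N)
    (path0' : smap_comp path (sprod_map (simplex_map a) (smap_id _)) j
       (@idm Delta j, end0 j) = M')
    (path1' : smap_comp path (sprod_map (simplex_map a) (smap_id _)) j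
       (@idm Delta j, end1 j) = N') i p q :
  hcast p q (path_nt path0' path1' i) = path_nt path0 path1 (a i).
Proof.
rewrite /path_nt /= /path_arr.
have E : comp a (edge_map (lexx i)) = edge_map (lexx (a i)) :> @hom Delta 1 k.
  by apply: mono_ext => /= b; case: (val b).
move: (path_ob0 _ _) (path_ob1 _ _) (path_ob0 _ _) (path_ob1 _ _).
move: (cell_ob _ _ _ _) (cell_ob _ _ _ _) (cell_ob _ _ _ _) (cell_ob _ _ _ _).
rewrite /= -E => *.
by rewrite !hcast_trans; exact: hcast_irr.
Qed.

(** * The iso-comma groupoid and its nerve *)

Section IsoComma.
Variables (X Y Z : Groupoid) (p : Functor X Z) (q : Functor Y Z).

(** As [Z] is a groupoid, [ic_iso] is automatically invertible, so this comma category is the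
    iso-comma. *)
Record icomma_ob := {
  ic_l : X;
  ic_r : Y;
  ic_iso : hom (p ic_l) (q ic_r) }.

Record icomma_hom (s t : icomma_ob) := {
  ih_l : hom (ic_l s) (ic_l t);
  ih_r : hom (ic_r s) (ic_r t);
  ih_sq : fmap q ih_r ∘ ic_iso s = ic_iso t ∘ fmap p ih_l }.

Lemma icomma_hom_ext s t (u v : icomma_hom s t) :
  ih_l u = ih_l v -> ih_r u = ih_r v -> u = v.
Proof.
case: u => a b e; case: v => a' b' e' /= aa bb; subst a' b'.
by rewrite (Prop_irrelevance e e').
Qed.

Program Definition icomma_cat : Category :=
  {| ob := icomma_ob;
     hom := icomma_hom;
     idm s := {| ih_l := idm (ic_l s); ih_r := idm (ic_r s) |};
     comp s t u g f := {| ih_l := ih_l g ∘ ih_l f; ih_r := ih_r g ∘ ih_r f |} |}.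
Next Obligation. by move=> s; rewrite !fmap_id comp_idl comp_idr. Qed.
Next Obligation.
move=> s t u g f; rewrite !fmap_comp -comp_assoc ih_sq comp_assoc ih_sq.
by rewrite comp_assoc.
Qed.
Next Obligation. by move=> *; apply: icomma_hom_ext; rewrite /= comp_idl. Qed.
Next Obligation. by move=> *; apply: icomma_hom_ext; rewrite /= comp_idr. Qed.
Next Obligation. by move=> *; apply: icomma_hom_ext; rewrite /= comp_assoc. Qed.

Program Definition icomma : Groupoid :=
  {| gcat := icomma_cat;
     ginv s t f := {| ih_l := ginv (ih_l f); ih_r := ginv (ih_r f) |} |}.
Next Obligation.
move=> s t f /=.
rewrite -[LHS]comp_idr -(fmap_id p) -(ginvr (ih_l f)) fmap_comp -!comp_assoc.
rewrite (comp_assoc (ic_iso t)) -ih_sq !comp_assoc -fmap_comp ginvl fmap_id.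
by rewrite comp_idl.
Qed.
Next Obligation. by move=> *; apply: icomma_hom_ext; rewrite /= ginvl. Qed.
Next Obligation. by move=> *; apply: icomma_hom_ext; rewrite /= ginvr. Qed.

Definition icomma_l : Functor icomma X :=
  {| fob (s : icomma) := ic_l s; fmap s t f := ih_l f;
     fmap_id _ := erefl; fmap_comp _ _ _ _ _ := erefl |}.

Definition icomma_r : Functor icomma Y :=
  {| fob (s : icomma) := ic_r s; fmap s t f := ih_r f;
     fmap_id _ := erefl; fmap_comp _ _ _ _ _ := erefl |}.

Definition icomma_nt :
    NatTrans (comp_functor p icomma_l) (comp_functor q icomma_r) :=
  {| nt (s : icomma) := ic_iso s : hom (comp_functor p icomma_l s)
                                       (comp_functor q icomma_r s);
     nt_natural s t f := esym (ih_sq f) |}.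

Lemma icomma_functor_ext (C : Category) (F G : Functor C icomma)
    (l : forall x, ic_l (F x) = ic_l (G x))
    (r : forall x, ic_r (F x) = ic_r (G x)) :
  (forall x p1 p2, hcast p1 p2 (ic_iso (F x)) = ic_iso (G x)) ->
  (forall x y (f : hom x y), hcast (l x) (l y) (ih_l (fmap F f)) = ih_l (fmap G f)) ->
  (forall x y (f : hom x y), hcast (r x) (r y) (ih_r (fmap F f)) = ih_r (fmap G f)) ->
  F = G.
Proof.
move=> FGi FGl FGr.
have E x : F x = G x.
  move: (l x) (r x) (FGi x); case: (F x) => a b c; case: (G x) => a' b' c' /=.
  by move=> aa bb; subst a' b' => /(_ erefl erefl) /= <-.
apply: (functor_ext (e := E)) => x y f.
have keyl (s s' t t' : icomma) (e : s = s') (e' : t = t') u v (h : hom s t) :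
  ih_l (hcast e e' h) = hcast u v (ih_l h) by subst; rewrite !hcast_id.
have keyr (s s' t t' : icomma) (e : s = s') (e' : t = t') u v (h : hom s t) :
  ih_r (hcast e e' h) = hcast u v (ih_r h) by subst; rewrite !hcast_id.
by apply: icomma_hom_ext; rewrite ?(keyl _ _ _ _ _ _ (l x) (l y))
  ?(keyr _ _ _ _ _ _ (r x) (r y)).
Qed.

End IsoComma.

Section NerveComma.
Variables (X Y Z : Groupoid) (p : Functor X Z) (q : Functor Y Z).

Let hpb := homotopy_pullback (nerve_map p) (nerve_map q).

Lemma cell_path0 k (s : hpb k) :
  hpb_path s k (@idm Delta k, end0 k) = comp_functor p (hpb_l s).
Proof. exact: (hpb_end0 s). Qed.

Lemma cell_path1 k (s : hpb k) :
  hpb_path s k (@idm Delta k, end1 k) = comp_functor q (hpb_r s).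
Proof. exact: (hpb_end1 s). Qed.

Definition cell_nt k (s : hpb k) :
    NatTrans (comp_functor p (hpb_l s)) (comp_functor q (hpb_r s)) :=
  path_nt (cell_path0 s) (cell_path1 s).

Program Definition comma_cell k (s : hpb k) : Functor (ord_cat k) (icomma p q) :=
  {| fob i := {| ic_l := hpb_l s i; ic_r := hpb_r s i; ic_iso := cell_nt s i |};
     fmap i j ij := {| ih_l := fmap (hpb_l s) ij; ih_r := fmap (hpb_r s) ij |} |}.
Next Obligation. by move=> k s i j ij; rewrite -(nt_natural (cell_nt s)). Qed.
Next Obligation. by move=> k s i; apply: icomma_hom_ext; rewrite /= fmap_id. Qed.
Next Obligation. by move=> *; apply: icomma_hom_ext; rewrite /= fmap_comp. Qed.

Definition hpb_to_comma : sMap hpb (nerve (icomma p q)).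
Proof.
refine {| smap k (s : hpb k) := (comma_cell s : nerve (icomma p q) k) |}.
move=> m n a s.
apply: (@icomma_functor_ext _ _ _ p q _ (comma_cell (sact a s))
  (comp_functor (comma_cell s) (ord_functor a)) (fun=> erefl) (fun=> erefl)) => //.
move=> i p1 p2.
exact: (path_nt_act (cell_path0 s) (cell_path1 s) (cell_path0 (sact a s))
  (cell_path1 (sact a s)) p1 p2).
Defined.

(** The tautological transformation [icomma_nt] is a homotopy between the two composites to [Z];
    here its cylinder is evaluated on the simplex [c]. *)
Definition comma_path k (c : nerve (icomma p q) k) : path_space (nerve Z) k.
Proof.
refine (smap_comp (cylinder_map (icomma_nt p q)) (sprod_map _ (smap_id _))).
exact: {| smap j (s : simplex k j) := sact s c;
          smap_act _ _ _ _ := sact_comp _ _ _ |}.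
Defined.

Lemma comma_path_end0 k (c : nerve (icomma p q) k) :
  path_end0 _ k (comma_path c) = nerve_map p k (nerve_map (icomma_l p q) k c).
Proof.
rewrite /= [LHS]cylinder_end0.
exact: (@functor_ext _ _
  (comp_functor (comp_functor p (icomma_l p q))
     (comp_functor c (ord_functor (mono_id 'I_k.+1))))
  (comp_functor p (comp_functor (icomma_l p q) c))
  (fun=> erefl) (fun _ _ _ => erefl)).
Qed.

Lemma comma_path_end1 k (c : nerve (icomma p q) k) :
  path_end1 _ k (comma_path c) = nerve_map q k (nerve_map (icomma_r p q) k c).
Proof.
rewrite /= [LHS]cylinder_end1.
exact: (@functor_ext _ _
  (comp_functor (comp_functor q (icomma_r p q))
     (comp_functor c (ord_functor (mono_id 'I_k.+1))))
  (comp_functor q (comp_functor (icomma_r p q) c))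
  (fun=> erefl) (fun _ _ _ => erefl)).
Qed.

Definition comma_to_hpb : sMap (nerve (icomma p q)) hpb.
Proof.
refine {| smap k (c : nerve (icomma p q) k) :=
  ({| hpb_l := nerve_map (icomma_l p q) k c;
      hpb_r := nerve_map (icomma_r p q) k c;
      hpb_end0 := comma_path_end0 c;
      hpb_end1 := comma_path_end1 c |} : hpb k) |}.
move=> m n a c; apply: hpb_cell_ext => /=.
- exact: (smap_act (nerve_map (icomma_l p q))).
- exact: (smap_act (nerve_map (icomma_r p q))).
- apply: smap_ext => i [s t] /=.
  exact: (@functor_ext _ _
    (cylinder (icomma_nt p q)
      (comp_functor (comp_functor c (ord_functor a)) (ord_functor s)) t)
    (cylinder (icomma_nt p q) (comp_functor c (ord_functor (mono_comp a s))) t)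
    (fun=> erefl) (fun _ _ _ => erefl)).
Defined.

(** The path is recovered by [path_cylinder]. This makes the homotopy pullback a retract of the
    nerve of the iso-comma groupoid, which suffices to carry an equivalence with that nerve back to
    it. *)
Lemma hpb_to_commaK k (s : hpb k) : comma_to_hpb k (hpb_to_comma k s) = s.
Proof.
apply: hpb_cell_ext.
- exact: (@functor_ext _ _ (comp_functor (icomma_l p q) (comma_cell s)) (hpb_l s)
    (fun=> erefl) (fun _ _ _ => erefl)).
- exact: (@functor_ext _ _ (comp_functor (icomma_r p q) (comma_cell s)) (hpb_r s)
    (fun=> erefl) (fun _ _ _ => erefl)).
- apply: smap_ext => j [a t].
  rewrite (path_cylinder (cell_path0 s) (cell_path1 s) a t).
  exact: (@functor_ext _ _
    (cylinder (icomma_nt p q) (comp_functor (comma_cell s) (ord_functor a)) t)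
    (cylinder (path_nt (cell_path0 s) (cell_path1 s)) (ord_functor a) t)
    (fun=> erefl) (fun _ _ _ => erefl)).
Qed.

End NerveComma.

(** * Equivalences of groupoids and homotopy pullback squares *)

Definition id_functor (C : Category) : Functor C C :=
  {| fob x := x; fmap x y f := f; fmap_id _ := erefl;
     fmap_comp _ _ _ _ _ := erefl |}.

(** The conclusion asks for natural transformations only: between groupoids each of them yields a
    homotopy of nerves, by [nerve_map_homotopic]. *)
Lemma quasi_inverse (C D : Category) (K : Functor C D) :
  (forall x y (g : hom (K x) (K y)), exists! f : hom x y, fmap K f = g) ->
  (forall d, exists (c : C) (f : hom (K c) d) (g : hom d (K c)),
     f ∘ g = idm d /\ g ∘ f = idm (K c)) ->
  exists R : Functor D C,
    inhabited (NatTrans (comp_functor R K) (id_functor _)) /\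
    inhabited (NatTrans (comp_functor K R) (id_functor _)).
Proof.
move=> Kff Kes.
have Kinj x y (f f' : hom x y) : fmap K f = fmap K f' -> f = f'.
  by move=> E; have [h [_ hu]] := Kff _ _ (fmap K f'); rewrite -(hu f') ?(hu f).
pose lift x y (g : hom (K x) (K y)) := proj1_sig (cid (Kff x y g)).
have liftK x y (g : hom (K x) (K y)) : fmap K (lift x y g) = g.
  by rewrite /lift; case: cid => f [].
pose r d := proj1_sig (cid (Kes d)).
have rP d : exists (f : hom (K (r d)) d) (g : hom d (K (r d))),
    f ∘ g = idm d /\ g ∘ f = idm (K (r d)) by rewrite /r; case: cid.
pose f d := proj1_sig (cid (rP d)).
have fP d : exists g : hom d (K (r d)),
    f d ∘ g = idm d /\ g ∘ f d = idm (K (r d)) by rewrite /f; case: cid.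
pose g d := proj1_sig (cid (fP d)).
have fg d : f d ∘ g d = idm d by rewrite /g; case: cid => ? [].
have gf d : g d ∘ f d = idm _ by rewrite /g; case: cid => ? [].
have Rid d : lift _ _ (g d ∘ idm d ∘ f d) = idm (r d).
  by apply: Kinj; rewrite liftK fmap_id comp_idr gf.
have Rcomp x y z (v : hom y z) (u : hom x y) :
    lift _ _ (g z ∘ (v ∘ u) ∘ f x) =
    lift _ _ (g z ∘ v ∘ f y) ∘ lift _ _ (g y ∘ u ∘ f x).
  apply: Kinj; rewrite fmap_comp !liftK -!comp_assoc (comp_assoc (f y)) fg.
  by rewrite comp_idl.
pose R : Functor D C := {| fob d := r d : C;
  fmap x y u := lift _ _ (g y ∘ u ∘ f x); fmap_id := Rid; fmap_comp := Rcomp |}.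
exists R; split.
- have nat x y (u : hom x y) :
      lift _ _ (f (K y)) ∘ lift _ _ (g (K y) ∘ fmap K u ∘ f (K x)) =
      u ∘ lift _ _ (f (K x)).
    by apply: Kinj; rewrite !fmap_comp !liftK !comp_assoc fg comp_idl.
  apply: inhabits; exact: (@Build_NatTrans _ _ (comp_functor R K) (id_functor _)
    (fun x => lift (r (K x)) x (f (K x))) nat).
- have nat x y (u : hom x y) : f y ∘ fmap K (lift _ _ (g y ∘ u ∘ f x)) = u ∘ f x.
    by rewrite liftK !comp_assoc fg comp_idl.
  apply: inhabits; exact: (@Build_NatTrans _ _ (comp_functor K R) (id_functor _)
    (fun x => f x) nat).
Qed.

(** Components are transported identities, so a strictly commuting square of functors provides the
    arrow [ic_iso] of [to_icomma_ob]. *)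
Definition functor_eq_nt (C D : Category) (F G : Functor C D) (E : F = G) :
  NatTrans F G.
Proof.
refine {| nt x := hcast erefl (congr1 (fun H : Functor C D => H x) E) (idm (F x)) |}.
by move=> x y f; case: G / E; rewrite /= comp_idl comp_idr.
Defined.

Lemma nerve_map_comp (B C D : Groupoid) (G : Functor C D) (F : Functor B C) n
  (c : nerve B n) :
  nerve_map (comp_functor G F) n c = nerve_map G n (nerve_map F n c).
Proof.
exact: (@functor_ext _ _ (comp_functor (comp_functor G F) c)
  (comp_functor G (comp_functor F c)) (fun=> erefl) (fun _ _ _ => erefl)).
Qed.

Lemma nerve_map_id (C : Groupoid) n (c : nerve C n) :
  nerve_map (id_functor C) n c = c.
Proof.
exact: (@functor_ext _ _ (comp_functor (id_functor C) c) c (fun=> erefl)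
  (fun _ _ _ => erefl)).
Qed.

Section NerveSquare.
Variables (W X Y Z : Groupoid).
Variables (U : Functor W X) (V : Functor W Y) (p : Functor X Z) (q : Functor Y Z).
Hypothesis sq : comp_functor p U = comp_functor q V.

Definition to_icomma_ob (w : W) : icomma p q :=
  {| ic_l := U w; ic_r := V w; ic_iso := functor_eq_nt sq w |}.

Definition to_icomma : Functor W (icomma p q).
Proof.
refine {| fob w := to_icomma_ob w;
          fmap w w' f := @Build_icomma_hom _ _ _ p q (to_icomma_ob w)
            (to_icomma_ob w') (fmap U f) (fmap V f)
            (esym (nt_natural (functor_eq_nt sq) f)) |}.
- by move=> w; apply: icomma_hom_ext; rewrite /= fmap_id.
- by move=> *; apply: icomma_hom_ext; rewrite /= fmap_comp.
Defined.

Lemma nerve_sq n (w : nerve W n) :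
  nerve_map p n (nerve_map U n w) = nerve_map q n (nerve_map V n w).
Proof.
rewrite /= in w *.
have -> : comp_functor p (comp_functor U w) = comp_functor (comp_functor p U) w.
  exact: (@functor_ext _ _ (comp_functor p (comp_functor U w))
    (comp_functor (comp_functor p U) w) (fun=> erefl) (fun _ _ _ => erefl)).
rewrite sq.
exact: (@functor_ext _ _ (comp_functor (comp_functor q V) w)
  (comp_functor q (comp_functor V w)) (fun=> erefl) (fun _ _ _ => erefl)).
Qed.

(** The comparison map uses constant paths, whose vertical edges are identities up to a cast, and
    [functor_eq_nt] is an identity under such a cast. *)
Lemma comparison_to_icomma n (w : nerve W n) :
  hpb_to_comma p q n (hpb_comparison nerve_sq n w) = nerve_map to_icomma n w.
Proof.
apply: (@icomma_functor_ext _ _ _ p q _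
  (comma_cell (hpb_comparison nerve_sq n w)) (comp_functor to_icomma w)
  (fun=> erefl) (fun=> erefl)) => //.
move=> i p1 p2; rewrite /= /path_arr /=.
have -> : fmap w (lexx (i : 'I_n.+1) : @hom (ord_cat n) i i) = idm (w i).
  by rewrite -fmap_id; congr fmap; exact: bool_irrelevance.
rewrite !fmap_id !hcast_trans.
exact: (@hcast_irr Z _ _ _ _ _ erefl _
  (congr1 (fun H : Functor W Z => H (w i)) sq) (idm (p (U (w i))))).
Qed.

Lemma nerve_homotopy_pullback :
  (forall x y (g : hom (to_icomma x) (to_icomma y)),
     exists! f : hom x y, fmap to_icomma f = g) ->
  (forall d, exists c, inhabited (hom (to_icomma c) d)) ->
  is_homotopy_pullback (nerve_map U) (nerve_map V) (nerve_map p) (nerve_map q).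
Proof.
move=> ff es; exists nerve_sq.
have [d|R [[s] [t]]] := quasi_inverse ff.
  by have [c [f]] := es d; exists c, f, (ginv f); rewrite ginvl ginvr.
(* The inverse passes to the iso-comma groupoid and applies [R]. The homotopy for the second
   composite is formed there and carried back along the retraction [comma_to_hpb]. *)
exists (smap_comp (nerve_map R) (hpb_to_comma p q)); split.
- have [H HP] := nerve_map_homotopic s.
  exists H => n w; have [H0 H1] := HP n w; split.
    by rewrite H0 nerve_map_comp -(comparison_to_icomma w).
  by rewrite H1 nerve_map_id.
- have [H HP] := nerve_map_homotopic t.
  exists (smap_comp (comma_to_hpb p q) (smap_comp H
    (sprod_map (hpb_to_comma p q) (smap_id _)))) => n c.
  have [H0 H1] := HP n (hpb_to_comma p q n c); split.
    rewrite [LHS](congr1 (comma_to_hpb p q n) H0) nerve_map_comp.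
    by rewrite -(comparison_to_icomma (nerve_map R n _)) hpb_to_commaK.
  by rewrite [LHS](congr1 (comma_to_hpb p q n) H1) nerve_map_id hpb_to_commaK.
Qed.

End NerveSquare.

(** * Abelian categories *)

Section Preadditive.
Variable A : Preadditive.

Lemma hadd_idem (x y : A) (f : hom x y) : hadd f f = f -> f = hzero x y.
Proof.
by move=> ff; rewrite -[LHS]hadd0 -(haddN f) -haddA ff.
Qed.

Lemma comp0l (x y z : A) (f : hom x y) : hzero y z ∘ f = hzero x z.
Proof. by apply: hadd_idem; rewrite -comp_addl hadd0. Qed.

Lemma comp0r (x y z : A) (f : hom y z) : f ∘ hzero x y = hzero x z.
Proof. by apply: hadd_idem; rewrite -comp_addr hadd0. Qed.

Lemma hopp_uniq (x y : A) (f g : hom x y) : hadd f g = hzero x y -> f = hopp g.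
Proof.
by move=> fg; rewrite -[f]hadd0 haddC -(haddN g) (haddC _ g) haddA fg hadd0.
Qed.

Lemma comp_oppr (x y z : A) (g : hom y z) (f : hom x y) :
  g ∘ hopp f = hopp (g ∘ f).
Proof.
by apply: hopp_uniq; rewrite -comp_addr haddN comp0r.
Qed.

Lemma hsub_eq0 (x y : A) (f g : hom x y) : hadd f (hopp g) = hzero x y -> f = g.
Proof.
by move=> fg; rewrite -[g]hadd0 -fg -haddA haddN haddC hadd0.
Qed.

Lemma mono0 (x y : A) (f : hom x y) :
  (forall w (u : hom w x), f ∘ u = hzero w y -> u = hzero w x) -> is_mono f.
Proof.
move=> f0 w u v fuv; apply: hsub_eq0; apply: f0.
by rewrite comp_addr comp_oppr fuv haddC haddN.
Qed.

Lemma mono_eq0 (x y : A) (f : hom x y) w (u : hom w x) :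
  is_mono f -> f ∘ u = hzero w y -> u = hzero w x.
Proof. by move=> fm fu; apply: fm; rewrite fu comp0r. Qed.

Lemma comp_oppl (x y z : A) (g : hom y z) (f : hom x y) :
  hopp g ∘ f = hopp (g ∘ f).
Proof.
by apply: hopp_uniq; rewrite -comp_addl haddN comp0l.
Qed.

Lemma epi0 (x y : A) (f : hom x y) :
  (forall z (u : hom y z), u ∘ f = hzero x z -> u = hzero y z) -> is_epi f.
Proof.
move=> f0 w u v fuv; apply: hsub_eq0; apply: f0.
by rewrite comp_addl comp_oppl fuv haddC haddN.
Qed.

Lemma epi_eq0 (x y : A) (f : hom x y) z (u : hom y z) :
  is_epi f -> u ∘ f = hzero x z -> u = hzero y z.
Proof. by move=> fe fu; apply: fe; rewrite fu comp0l. Qed.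

Lemma kernel_mono (k x y : A) (i : hom k x) (f : hom x y) :
  is_kernel i f -> is_mono i.
Proof.
case=> fi iP w u v iuv; have [|t [_ tu]] := iP w (i ∘ u).
  by rewrite comp_assoc fi comp0l.
by rewrite -(tu u) // -(tu v).
Qed.

Lemma cokernel_epi (x y c : A) (p : hom y c) (f : hom x y) :
  is_cokernel p f -> is_epi p.
Proof.
case=> pf pP w u v puv; have [|t [_ tu]] := pP w (u ∘ p).
  by rewrite -comp_assoc pf comp0r.
by rewrite -(tu u) // -(tu v).
Qed.

Lemma to_zero_eq0 (z : A) : is_zero_object z ->
  forall x (f : hom x z), f = hzero x z.
Proof. by case=> _ zt x f; have [g gP] := zt x; rewrite (gP f) [RHS]gP. Qed.

Lemma from_zero_eq0 (z : A) : is_zero_object z ->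
  forall x (f : hom z x), f = hzero z x.
Proof. by case=> zi _ x f; have [g gP] := zi x; rewrite (gP f) [RHS]gP. Qed.

Lemma zero_object_idm (z : A) : idm z = hzero z z -> is_zero_object z.
Proof.
move=> z0; split=> x; exists (hzero _ _) => g.
  by rewrite -[g]comp_idr z0 comp0r.
by rewrite -[g]comp_idl z0 comp0l.
Qed.

End Preadditive.

Section Abelian.
Variable A : AbelianCategory.

(** A monic is the kernel of some [g], and [g] factors through the cokernel [p], so whatever [p]
    kills is killed by [g]. *)
Lemma mono_exact (x y z : A) (f : hom x y) (p : hom y z) :
  is_mono f -> is_cokernel p f ->
  forall w (u : hom w y), p ∘ u = hzero w z -> exists v, f ∘ v = u.
Proof.
move=> fm [_ pP] w u pu; have [c [g [gf gP]]] := mono_is_kernel fm.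
have [h [hp _]] := pP _ g gf.
have [|v [fv _]] := gP w u; last by exists v.
by rewrite -hp -comp_assoc pu comp0r.
Qed.

Lemma epi_exact_cokernel (x y z : A) (f : hom x y) (p : hom y z) :
  is_epi p -> p ∘ f = hzero x z ->
  (forall w (u : hom w y), p ∘ u = hzero w z -> exists v, f ∘ v = u) ->
  is_cokernel p f.
Proof.
move=> pe pf ex; split=> // c u uf; have [w [g [pg gP]]] := epi_is_cokernel pe.
have [v fv] := ex _ _ pg; apply: gP.
by rewrite -fv comp_assoc uf comp0l.
Qed.

(** Epimorphisms are stable under pullback; the pullback is the kernel of [p p1 - u p2] on the
    biproduct of [x] and [w]. In chases this replaces picking a preimage of an element. *)
Lemma epi_lift (x y w : A) (p : hom x y) (u : hom w y) : is_epi p ->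
  exists (w' : A) (e : hom w' w) (v : hom w' x), is_epi e /\ p ∘ v = u ∘ e.
Proof.
move=> pe; have [s [i1 [i2 [p1 [p2 [E11 E22 E21 E12 Es]]]]]] := has_biproducts x w.
pose f : hom s y := hadd (p ∘ p1) (hopp (u ∘ p2)).
have fi1 : f ∘ i1 = p.
  rewrite comp_addl comp_oppl -!comp_assoc E11 E21 comp0r comp_idr.
  have -> : hopp (hzero x y) = hzero x y.
    by rewrite -[LHS]hadd0 haddC haddN.
  by rewrite haddC hadd0.
have fe : is_epi f.
  by move=> z a b ab; apply: pe; rewrite -fi1 !comp_assoc ab.
have [k [i ik]] := has_kernels f; exists k, (p2 ∘ i), (p1 ∘ i); split; last first.
  apply: hsub_eq0; rewrite !comp_assoc -comp_oppl -comp_addl.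
  by case: ik.
have [k' [g [fg gP]]] := epi_is_cokernel fe.
(* If [h] kills [p2 i], then [h p2] kills the kernel of [f] and equals some [h' f]. Restricting to
   [x] gives [h' p = 0], so [h'] and then [h] vanish. *)
apply: epi0 => z h hp.
have [|h' [hf _]] := gP z (h ∘ p2).
  have [t [it _]] := (proj2 ik) _ _ fg.
  by rewrite -it -comp_assoc (comp_assoc p2) comp_assoc hp comp0l.
have h'0 : h' = hzero y z.
  apply: (epi_eq0 pe); rewrite -fi1 comp_assoc hf -comp_assoc E21.
  exact: comp0r.
by rewrite -[h]comp_idr -E22 comp_assoc -hf h'0 !comp0l.
Qed.

End Abelian.

(** * Gap complexes as quotients of filtrations *)

Section ThinFunctor.
Variables (A : Category) (d : Order.disp_t) (I : orderType d) (K : Functor (Ar I) A).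

(** Arrows of [Ar I] are proofs of a boolean, so the composite may be named by any arrow [h] at
    hand. *)
Lemma ar_comp (x y z : Ar I) (g : hom y z) (f : hom x y) (h : hom x z) :
  fmap K g ∘ fmap K f = fmap K h.
Proof. by rewrite -fmap_comp; congr fmap; exact: bool_irrelevance. Qed.

Lemma ar_compA (x y z : Ar I) (g : hom y z) (f : hom x y) (h : hom x z)
    w (u : hom w (K x)) : fmap K g ∘ (fmap K f ∘ u) = fmap K h ∘ u.
Proof. by rewrite comp_assoc (ar_comp _ _ h). Qed.

Lemma ar_id (x : Ar I) (f : hom x x) : fmap K f = idm (K x).
Proof. by rewrite -fmap_id; congr fmap; exact: bool_irrelevance. Qed.

End ThinFunctor.

Arguments ar_compA {A d I} K {x y z} g f h {w} u.

Section GapExact.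
Variables (A : AbelianCategory) (d : Order.disp_t) (I : orderType d).
Variables (K : Functor (Ar I) A) (gapK : is_gap K).

Lemma gap_zero_ob (x : Ar I) : ar_src x = ar_tgt x -> is_zero_object (K x).
Proof.
case: x => i j ij /= ji; subst j.
by rewrite (bool_irrelevance ij (lexx i)); apply: (proj1 gapK).
Qed.

Lemma gap_mono (x y : Ar I) (f : hom x y) :
  ar_src x = ar_src y -> is_mono (fmap K f).
Proof.
case: x y f => i j ij [i' k ik] f /= ii; subst i'.
have /andP[_ jk] := f.
have l : hom (ar ij) (ar (lexx j)) by rewrite /= /ar_rel /= ij lexx.
have r : hom (ar ik) (ar jk) by rewrite /= /ar_rel /= ij lexx.
have b : hom (ar (lexx j)) (ar jk) by rewrite /= /ar_rel /= jk lexx.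
by case: (is_gap_square gapK f l r b).
Qed.

Lemma gap_epi (x y : Ar I) (f : hom x y) :
  ar_tgt x = ar_tgt y -> is_epi (fmap K f).
Proof.
case: x y f => i k ik [j k' jk] f /= kk; subst k'.
have /andP[/= ij _] := f.
have l : hom (ar ij) (ar (lexx j)) by rewrite /= /ar_rel /= ij lexx.
have t : hom (ar ij) (ar ik) by rewrite /= /ar_rel /= jk lexx.
have b : hom (ar (lexx j)) (ar jk) by rewrite /= /ar_rel /= jk lexx.
by case: (is_gap_square gapK t l f b).
Qed.

(** The map factors through the zero object on the diagonal at [ar_tgt x]. *)
Lemma gap_zero (x y : Ar I) (f : hom x y) :
  (ar_tgt x <= ar_src y)%O -> fmap K f = hzero (K x) (K y).
Proof.
move=> xy; have /andP[xs xt] := f.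
pose z : Ar I := ar (lexx (ar_tgt x)).
have g : hom x z by rewrite /= /ar_rel /= (ar_le x) lexx.
have h : hom z y by rewrite /= /ar_rel /= xy.
rewrite -(ar_comp K h g) (to_zero_eq0 (gap_zero_ob (x := z) erefl) (fmap K g)).
exact: comp0r.
Qed.

Lemma gap_exact (x y z : Ar I) (f : hom x y) (g : hom y z)
    w (u : hom w (K y)) :
  ar_src x = ar_src y -> ar_tgt y = ar_tgt z -> ar_tgt x = ar_src z ->
  fmap K g ∘ u = hzero w (K z) -> exists v, fmap K f ∘ v = u.
Proof.
case: x y z f g u => i j ij [i' k ik] [j' k' jk] f g u /= ii kk jj.
subst i' j' k'.
have l : hom (ar ij) (ar (lexx j)) by rewrite /= /ar_rel /= ij lexx.
have b : hom (ar (lexx j)) (ar jk) by rewrite /= /ar_rel /= jk lexx.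
have [fm _ _ _ [_ po]] := is_gap_square gapK f l g b.
have [c [h [hf hP]]] := mono_is_kernel fm.
move=> gu; have [|v [fv _]] := hP w u; last by exists v.
(* The monic [fmap K f] is the kernel of [h]. By the pushout property [h] factors through
   [fmap K g], so [h] kills [u] as well. *)
have [|t [[tg _] _]] := po c h (hzero _ _); first by rewrite hf comp0l.
by rewrite -tg -comp_assoc gu comp0r.
Qed.

End GapExact.

Section Presentation.
Variable A : AbelianCategory.

Record sub (T : A) := {
  sdom : A;
  sarr :> hom sdom T;
  sarr_mono : is_mono sarr }.

Arguments sarr_mono {T} s [w] u v _.

(** Only a preorder: subobjects are not identified, and their equality is expressed below by [sle]
    in both directions. *)
Definition sle (T : A) (s s' : sub T) := exists t, sarr s' ∘ t = sarr s.

(* [K] is the gap complex of quotients of the filtration [c] of [T], with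
   quotient maps [q]. *)
Definition presents d (I : orderType d) (K : Functor (Ar I) A) (T : A)
    (c : I -> sub T) (q : forall x : Ar I, hom (sdom (c (ar_tgt x))) (K x)) :=
  [/\ forall i j, (i <= j)%O -> sle (c i) (c j),
      forall (x : Ar I) t, c (ar_tgt x) ∘ t = c (ar_src x) -> is_cokernel (q x) t
    & forall (x y : Ar I) (f : hom x y) t, c (ar_tgt y) ∘ t = c (ar_tgt x) ->
        fmap K f ∘ q x = q y ∘ t].

Arguments presents {d I} K {T} c q.

Section Compare.
Variables (d : Order.disp_t) (I : orderType d).

Lemma presents_epi (K : Functor (Ar I) A) (T : A) (c : I -> sub T) q :
  presents K c q -> forall x, is_epi (q x).
Proof.
case=> cm qc _ x; have [t ct] := cm _ _ (ar_le x).
exact: cokernel_epi (qc x t ct).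
Qed.

(** Restricted to the steps of the filtrations, [h] descends to the cokernels. The restriction [r]
    is unique since [c'] is monic, and naturality can be tested after the epic maps [q]. *)
Lemma presents_map (K K' : Functor (Ar I) A) (T T' : A) (c : I -> sub T)
    (c' : I -> sub T') q q' (h : hom T T') :
  presents K c q -> presents K' c' q' ->
  (forall i, exists r, c' i ∘ r = h ∘ c i) ->
  exists w : NatTrans K K', forall x r,
    c' (ar_tgt x) ∘ r = h ∘ c (ar_tgt x) -> w x ∘ q x = q' x ∘ r.
Proof.
move=> P P' hc; have [cm qc qn] := P; have [cm' qc' qn'] := P'.
have W x : exists w : hom (K x) (K' x), forall r,
    c' (ar_tgt x) ∘ r = h ∘ c (ar_tgt x) -> w ∘ q x = q' x ∘ r.
  have [r0 r0P] := hc (ar_src x); have [r1 r1P] := hc (ar_tgt x).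
  have [t ct] := cm _ _ (ar_le x); have [t' ct'] := cm' _ _ (ar_le x).
  have rt : r1 ∘ t = t' ∘ r0.
    apply: (@sarr_mono _ (c' (ar_tgt x))).
    by rewrite !comp_assoc r1P ct' r0P -comp_assoc ct.
  have [|w [wq _]] := (proj2 (qc x t ct)) _ (q' x ∘ r1).
    rewrite -comp_assoc rt comp_assoc.
    by case: (qc' x t' ct') => -> _; rewrite comp0l.
  exists w => r rP; rewrite wq; congr (_ ∘ _).
  by apply: (@sarr_mono _ (c' (ar_tgt x))); rewrite rP.
pose w x := proj1_sig (cid (W x)).
have wP x r : c' (ar_tgt x) ∘ r = h ∘ c (ar_tgt x) -> w x ∘ q x = q' x ∘ r.
  by rewrite /w; case: cid => w' /= H; apply: H.
have wn x y (f : hom x y) : w y ∘ fmap K f = fmap K' f ∘ w x.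
  apply: (presents_epi P).
  have /andP[_ xy] := f.
  have [rx rxP] := hc (ar_tgt x); have [ry ryP] := hc (ar_tgt y).
  have [t ct] := cm _ _ xy; have [t' ct'] := cm' _ _ xy.
  rewrite -!comp_assoc (qn _ _ f t ct) (wP x _ rxP) comp_assoc (wP y _ ryP).
  rewrite comp_assoc (qn' _ _ f t' ct') -!comp_assoc; congr (_ ∘ _).
  apply: (@sarr_mono _ (c' (ar_tgt y))).
  by rewrite !comp_assoc ryP ct' rxP -comp_assoc ct.
by exists {| nt x := w x; nt_natural := wn |} => x r /=; apply: wP.
Qed.

Lemma presents_iso (K K' : Functor (Ar I) A) (T : A) (c c' : I -> sub T) q q' :
  presents K c q -> presents K' c' q' ->
  (forall i, sle (c i) (c' i)) -> (forall i, sle (c' i) (c i)) ->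
  exists w : @Iso (functor_cat (Ar I) A) K K', forall x r,
    c' (ar_tgt x) ∘ r = c (ar_tgt x) ->
    (iso_hom w : NatTrans K K') x ∘ q x = q' x ∘ r.
Proof.
move=> P P' cc' c'c.
have [|w wP] := presents_map (h := idm T) P P'.
  by move=> i; have [r rP] := cc' i; exists r; rewrite comp_idl.
have [|v vP] := presents_map (h := idm T) P' P.
  by move=> i; have [r rP] := c'c i; exists r; rewrite comp_idl.
have vw : @comp (functor_cat (Ar I) A) _ _ _ v w = @idm (functor_cat (Ar I) A) K.
  apply: nt_ext => x /=; apply: (presents_epi P).
  have [r rP] := cc' (ar_tgt x); have [s sP] := c'c (ar_tgt x).
  rewrite -comp_assoc (wP x r) ?comp_idl // comp_assoc (vP x s) ?comp_idl //.
  rewrite -comp_assoc; have -> : s ∘ r = idm _; last by rewrite comp_idr.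
  by apply: (@sarr_mono _ (c (ar_tgt x))); rewrite comp_assoc sP rP comp_idr.
have wv : @comp (functor_cat (Ar I) A) _ _ _ w v = @idm (functor_cat (Ar I) A) K'.
  apply: nt_ext => x /=; apply: (presents_epi P').
  have [r rP] := cc' (ar_tgt x); have [s sP] := c'c (ar_tgt x).
  rewrite -comp_assoc (vP x s) ?comp_idl // comp_assoc (wP x r) ?comp_idl //.
  rewrite -comp_assoc; have -> : r ∘ s = idm _; last by rewrite comp_idr.
  by apply: (@sarr_mono _ (c' (ar_tgt x))); rewrite comp_assoc rP sP comp_idr.
exists (@Build_Iso (functor_cat (Ar I) A) K K' w v vw wv) => x r rP /=.
by apply: wP; rewrite comp_idl.
Qed.

End Compare.
Lemma presents_gap d (I : orderType d) (K : Functor (Ar I) A) (T : A)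
    (c : I -> sub T) q : presents K c q -> is_gap K.
Proof.
move=> P; have [cm qc qn] := P; have qe := presents_epi P.
have cid1 i : c i ∘ idm (sdom (c i)) = c i by rewrite comp_idr.
have zero i (ii : (i <= i)%O) : is_zero_object (K (ar ii)).
  apply: zero_object_idm; have [q0 _] := qc (ar ii) (idm _) (cid1 i).
  apply: (qe (ar ii)); rewrite comp_idl comp0l.
  by rewrite -[LHS]comp_idr q0.
split=> [i|i j k ij jk ik top left right bot]; first exact: zero.
have re : is_epi right.
  move=> z u v uv; apply: (qe (ar jk)).
  have := qn _ _ (ar_hom ik jk ij (lexx k)) _ (cid1 k).
  rewrite comp_idr => <-.
  by rewrite !comp_assoc uv.
have [tij tijP] := cm _ _ ij; have [tjk tjkP] := cm _ _ jk.
have tikP : c k ∘ (tjk ∘ tij) = c i by rewrite comp_assoc tjkP.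
have topq : top ∘ q (ar ij) = q (ar ik) ∘ tjk by apply: qn.
have rightq : right ∘ q (ar ik) = q (ar jk).
  by rewrite [LHS](qn _ _ (ar_hom ik jk ij (lexx k)) _ (cid1 k)) comp_idr.
have topm : is_mono top.
  (* Lift [u] along a cover to [v] in the step at [j]. As its image in the quotient at [(i, k)]
     vanishes, [v] comes from the step at [i], so it vanishes in the quotient at [(i, j)]. *)
  apply: mono0 => w u tu.
  have [w' [e [v [ee vP]]]] := epi_lift u (qe (ar ij)).
  have tm : is_mono (tjk ∘ tij).
    move=> z a b ab; apply: (@sarr_mono _ (c i)).
    by rewrite -tikP -!(comp_assoc (c k)) ab.
  have [|y yP] := mono_exact tm (qc (ar ik) _ tikP) (u := tjk ∘ v).
    by rewrite comp_assoc -topq -comp_assoc vP comp_assoc tu comp0l.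
  apply: (epi_eq0 ee); rewrite -vP.
  have <- : tij ∘ y = v.
    apply: (@sarr_mono _ (c j)).
    by rewrite -tjkP -!(comp_assoc (c k)) (comp_assoc tjk) yP.
  have [q0 _] := qc (ar ij) _ tijP.
  by rewrite comp_assoc q0 comp0l.
split=> //.
- move=> w u v _.
  by rewrite (to_zero_eq0 (zero j (lexx j)) u) (to_zero_eq0 (zero j (lexx j)) v).
- move=> w u v _; have zj := zero j (lexx j).
  by rewrite (from_zero_eq0 zj u) (from_zero_eq0 zj v).
split=> [|e u v uv].
  by rewrite /top /right /bot /left -!fmap_comp; congr fmap; exact: bool_irrelevance.
have ut : u ∘ top = hzero _ _.
  by rewrite uv (from_zero_eq0 (zero j (lexx j)) v) comp0l.
(* Since [u] kills the image of [top], its composite with the quotient map kills the step at [j] and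
   descends to the cokernel at [(j, k)]. *)
have [|w [wq _]] := (proj2 (qc (ar jk) tjk tjkP)) _ (u ∘ q (ar ik)).
  by rewrite -comp_assoc -topq comp_assoc ut comp0l.
exists w; split=> [|w' [w'u _]].
  split; last first.
    have zj := zero j (lexx j).
    by rewrite (from_zero_eq0 zj v) (from_zero_eq0 zj (_ ∘ _)).
  by apply: (qe (ar ik)); rewrite -comp_assoc rightq.
by apply: (qe (ar jk)); rewrite wq -rightq comp_assoc w'u.
Qed.

Lemma presents_exists d (I : orderType d) (T : A) (c : I -> sub T) :
  (forall i j, (i <= j)%O -> sle (c i) (c j)) ->
  exists (K : Functor (Ar I) A) q, presents K c q.
Proof.
move=> cm.
pose t (x : Ar I) := proj1_sig (cid (cm _ _ (ar_le x))).
have tP x : c (ar_tgt x) ∘ t x = c (ar_src x) by rewrite /t; case: cid.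
pose k x := proj1_sig (cid (has_cokernels (t x))).
have kP x : exists p : hom (sdom (c (ar_tgt x))) (k x), is_cokernel p (t x).
  by rewrite /k; case: cid.
pose q x := proj1_sig (cid (kP x)).
have qP x : is_cokernel (q x) (t x) by rewrite /q; case: cid.
have qe x : is_epi (q x) := cokernel_epi (qP x).
have M (x y : Ar I) (f : hom x y) : exists m : hom (k x) (k y), forall r,
    c (ar_tgt y) ∘ r = c (ar_tgt x) -> m ∘ q x = q y ∘ r.
  have /andP[/cm[s sP] /cm[r rP]] := f.
  have [|m [mP _]] := (proj2 (qP x)) _ (q y ∘ r).
    have rt : r ∘ t x = t y ∘ s.
      apply: (@sarr_mono _ (c (ar_tgt y))).
      by rewrite !comp_assoc rP !tP sP.
    by rewrite -comp_assoc rt comp_assoc (proj1 (qP y)) comp0l.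
  exists m => r' r'P; rewrite mP; congr (_ ∘ _).
  by apply: (@sarr_mono _ (c (ar_tgt y))); rewrite rP.
pose m x y (f : hom x y) := proj1_sig (cid (M x y f)).
have mP (x y : Ar I) (f : hom x y) r : c (ar_tgt y) ∘ r = c (ar_tgt x) ->
    m x y f ∘ q x = q y ∘ r.
  by rewrite /m; case: cid => m' /= H; apply: H.
have m1 (x : Ar I) : m x x (idm x) = idm (k x).
  by apply: qe; rewrite (mP _ _ _ (idm _)) ?comp_idl ?comp_idr.
have m2 (x y z : Ar I) (g : hom y z) (f : hom x y) :
    m x z (g ∘ f) = m y z g ∘ m x y f.
  have /andP[_ /cm[r rP]] := f; have /andP[_ /cm[s sP]] := g.
  apply: qe; rewrite (mP _ _ _ (s ∘ r)); last by rewrite comp_assoc sP.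
  by rewrite -comp_assoc (mP _ _ _ r) // !comp_assoc (mP _ _ _ s).
exists (@Build_Functor (Ar I) A k m m1 m2), q; split=> //= [x t' t'P].
suff -> : t' = t x by [].
by apply: (@sarr_mono _ (c (ar_tgt x))); rewrite tP.
Qed.

(* A subquotient [F (lo, hi)] of [T], with [E -> F (lo, hi)] epic and [E -> T]
   monic, pulls the filtration of [F (lo, hi)] back to [T]. *)
Lemma gap_presents d (I : orderType d) (F : Functor (Ar I) A) (T E : A)
    (lo hi : I) (lohi : (lo <= hi)%O) (i : hom E T) (p : hom E (F (ar lohi))) :
  is_gap F -> (forall j, (lo <= j <= hi)%O) -> is_mono i -> is_epi p ->
  exists (c : I -> sub T) (q : forall x, hom (sdom (c (ar_tgt x))) (F x)),
  [/\ presents F c q,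
      forall j (jhi : (j <= hi)%O) (f : hom (ar lohi) (ar jhi)),
        exists b, i ∘ b = c j /\ is_kernel b (fmap F f ∘ p)
    & forall (x : Ar I) (xhi : (ar_src x <= hi)%O) (f : hom (ar lohi) (ar xhi))
        (g : hom x (ar xhi)) b,
        i ∘ b = c (ar_tgt x) -> fmap F g ∘ q x = fmap F f ∘ p ∘ b].
Proof.
move=> Fgap bnd im pe.
have loj j : (lo <= j)%O by case/andP: (bnd j).
have jhi j : (j <= hi)%O by case/andP: (bnd j).
(* [F(lo, j)] is the kernel of [F(lo, hi) -> F(j, hi)], so its inverse image in [E] is the kernel of
   that map composed with [p]. *)
pose f j : @hom (Ar I) (ar lohi) (ar (jhi j)) :=
  ar_hom lohi (jhi j) (loj j) (lexx hi).
pose B j := cid (has_kernels (fmap F (f j) ∘ p)).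
pose k j := proj1_sig (B j).
have bex j : exists b : hom (k j) E, is_kernel b (fmap F (f j) ∘ p).
  by rewrite /k; case: (B j).
pose b j := proj1_sig (cid (bex j)).
have bP j : is_kernel (b j) (fmap F (f j) ∘ p) by rewrite /b; case: cid.
have sm j : is_mono (i ∘ b j).
  move=> w u v; rewrite -!comp_assoc => /im; exact: kernel_mono (bP j) _ _ _.
pose c j := Build_sub (@sm j).
(* For [x = (s, t)] the step at [t] maps to [F(s, hi)] and becomes zero in [F(t, hi)], so by
   exactness it lands in [F(s, t)]. *)
have Q (x : Ar I) : exists q : hom (k (ar_tgt x)) (F x),
    fmap F (ar_hom (ar_le x) (jhi (ar_src x)) (lexx _) (jhi _) : hom x _) ∘ q =
    fmap F (f (ar_src x)) ∘ p ∘ b (ar_tgt x).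
  have l : hom x (ar (jhi (ar_src x))) by exact: ar_hom.
  have r : hom (ar (jhi (ar_src x))) (ar (jhi (ar_tgt x))).
    by rewrite /= /ar_rel /= ar_le lexx.
  have [|v vP] := gap_exact Fgap l (g := r)
    (u := fmap F (f (ar_src x)) ∘ p ∘ b (ar_tgt x)) erefl erefl erefl.
    rewrite -comp_assoc (ar_compA F _ _ (f (ar_tgt x))) comp_assoc.
    by case: (bP (ar_tgt x)).
  by exists v; rewrite -vP; congr (fmap _ _ ∘ _); exact: bool_irrelevance.
pose q x := proj1_sig (cid (Q x)).
have qP (x : Ar I) (g : hom x (ar (jhi (ar_src x)))) :
    fmap F g ∘ q x = fmap F (f (ar_src x)) ∘ p ∘ b (ar_tgt x).
  rewrite /q; case: cid => q' /= <-.
  by congr (fmap _ _ ∘ _); exact: bool_irrelevance.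
have xm (x : Ar I) (g : hom x (ar (jhi (ar_src x)))) : is_mono (fmap F g).
  exact: gap_mono.
exists c, q; split.
- split.
  + move=> j j' jj.
    have r : hom (ar (jhi j)) (ar (jhi j')) by rewrite /= /ar_rel /= jj lexx.
    have [|v [vP _]] := (proj2 (bP j')) _ (b j).
      rewrite -(ar_comp F r (f j)) -!comp_assoc (comp_assoc _ p).
      by rewrite (proj1 (bP j)) comp0r.
    by exists v; rewrite /= -comp_assoc vP.
  + move=> x t /= ct.
    have bt : b (ar_tgt x) ∘ t = b (ar_src x) by apply: im; rewrite comp_assoc.
    have g : hom x (ar (jhi (ar_src x))) by exact: ar_hom.
    apply: epi_exact_cokernel.
    * have l : hom (ar (loj (ar_tgt x))) x by rewrite /= /ar_rel /= loj lexx.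
      have m : hom (ar (loj (ar_tgt x))) (ar lohi) by rewrite /= /ar_rel /= jhi lexx.
      have n : hom (ar (loj (ar_tgt x))) (ar (jhi (ar_src x))) := comp g l.
      have n0 : hom (ar (loj (ar_tgt x))) (ar (jhi (ar_tgt x))).
        by rewrite /= /ar_rel /= loj jhi.
      (* To see that [q x] is epic, with [x = (s, t)]: [F(lo, t) -> F(s, t)] is epic, and after a
         cover it factors through [q x], by lifting [F(lo, t) -> F(lo, hi)] along [p]. *)
      apply: epi0 => z h hq.
      have [w [e [v [ee pv]]]] := epi_lift (fmap F m) pe.
      have [|v' [bv' _]] := (proj2 (bP (ar_tgt x))) _ v.
        by rewrite -comp_assoc pv (ar_compA F _ _ n0) gap_zero ?comp0l.
      apply: (epi_eq0 (f := fmap F l)); first by apply: gap_epi.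
      apply: (epi_eq0 ee); rewrite -comp_assoc.
      have <- : q x ∘ v' = fmap F l ∘ e.
        apply: (xm x g); rewrite comp_assoc qP -comp_assoc bv' -comp_assoc pv.
        by rewrite !(ar_compA F _ _ n).
      by rewrite comp_assoc hq comp0l.
    * by apply: (xm x g); rewrite comp_assoc qP -comp_assoc bt (proj1 (bP _)) comp0r.
    * move=> w u qu.
      have [|v [bv _]] := (proj2 (bP (ar_src x))) _ (b (ar_tgt x) ∘ u).
        by rewrite comp_assoc -(qP x g) -comp_assoc qu comp0r.
      exists v; apply: (kernel_mono (bP (ar_tgt x))).
      by rewrite comp_assoc bt.
  + move=> x y g t /= ct.
    have bt : b (ar_tgt y) ∘ t = b (ar_tgt x) by apply: im; rewrite comp_assoc.
    have gx : hom x (ar (jhi (ar_src x))) by exact: ar_hom.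
    have gy : hom y (ar (jhi (ar_src y))) by exact: ar_hom.
    have /andP[sxy _] := g.
    have r : hom (ar (jhi (ar_src x))) (ar (jhi (ar_src y))).
      by rewrite /= /ar_rel /= sxy lexx.
    apply: (xm y gy); rewrite comp_assoc (comp_assoc _ (q y)) qP.
    rewrite (ar_comp F _ _ (comp gy g)) -(ar_comp F r gx) -comp_assoc qP.
    by rewrite -!comp_assoc (ar_compA F _ _ (f (ar_src y))) bt.
- move=> j jhi'; rewrite (bool_irrelevance jhi' (jhi j)) => f'.
  by rewrite (bool_irrelevance f' (f j)); exists (b j); split=> //; exact: bP.
- move=> x xhi; rewrite (bool_irrelevance xhi (jhi (ar_src x))) => f' g b' ib'.
  rewrite (bool_irrelevance f' (f (ar_src x))).
  have -> : b' = b (ar_tgt x) by apply: im.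
  exact: qP.
Qed.

End Presentation.

Arguments presents {A d I} K {T} c q.
Arguments sarr_mono {A T} s [w] u v _.

(** * Active-inert pushouts in Delta *)

(** An inert map is the translation by [f ord0]. *)
Lemma inert_le (m n : Delta) (f : hom m n) : inert f ->
  forall i j, (f i <= f j)%O -> (i <= j)%O.
Proof.
move=> fi; have fE i : f i = f ord0 + i :> nat.
  case: i => i; elim: i => [|i IH] im.
    by rewrite addn0; congr (nat_of_ord (f _)); apply: val_inj.
  have im' : i < m.+1 by exact: ltnW.
  by rewrite (fi (Ordinal im') (Ordinal im)) // IH addnS.
by move=> i j; rewrite !leEord (fE i) (fE j) leq_add2l.
Qed.

Section DeltaPushout.
Variables (m n m' n' : Delta) (g : hom m n) (f : hom m m').
Variables (f' : hom n n') (g' : hom m' n').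
Hypotheses (fle : forall i j, (f i <= f j)%O -> (i <= j)%O).
Hypothesis po : is_pushout g f g' f'.

Definition upset (k : nat) (U : 'I_k.+1 -> Prop) :=
  forall i j : 'I_k.+1, (i <= j)%O -> U i -> U j.

Definition cut_map k (U : 'I_k.+1 -> Prop) (uU : upset U) : @hom Delta k 1.
Proof.
refine {| mfun (i : 'I_k.+1) := if `[< U i >] then ord_max : 'I_2 else ord0 |}.
move=> i j ij; case: ifP => [/asboolP Ui|_] //.
by case: ifP => // /asboolP; case; apply: uU ij Ui.
Defined.

Lemma cut_mapP k (U : 'I_k.+1 -> Prop) (uU : upset U) i :
  cut_map uU i = ord_max <-> U i.
Proof.
rewrite /=; case: ifP => /asboolP Ui; split=> //.
Qed.

(* Cuts of [n] are maps to [1], so that the pushout is used only through its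
   universal property with respect to [1]. *)
Lemma pushout_cut (U : 'I_m'.+1 -> Prop) (V : 'I_n.+1 -> Prop) :
  upset U -> upset V -> (forall l, U (f l) <-> V (g l)) ->
  exists W : 'I_n'.+1 -> Prop,
    [/\ upset W, forall i, W (g' i) <-> U i & forall k, W (f' k) <-> V k].
Proof.
move=> uU uV UV.
have [|w [[wf wg] _]] := (proj2 po) _ (cut_map uV) (cut_map uU).
  apply: mono_ext => l /=; congr (if _ then _ else _).
  by apply/asboolP/asboolP => /UV.
exists (fun j => w j = ord_max); split.
- move=> i j ij wi; have := mfun_le w ij; rewrite wi => wj.
  by apply/le_anti/andP; split=> //; rewrite leEord -ltnS ltn_ord.
- by move=> i; rewrite -(cut_mapP uU) -wg.
- by move=> k; rewrite -(cut_mapP uV) -wf.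
Qed.

(** If [j] were missed, the cuts just below and just above [j] would have the same restrictions,
    against uniqueness. *)
Lemma pushout_surj j : (exists i, g' i = j) \/ (exists k, f' k = j).
Proof.
have [//|/not_orP[gj fj]] := pselect ((exists i, g' i = j) \/ (exists k, f' k = j)).
have u1 : upset (fun x : 'I_n'.+1 => (j <= x)%O) by move=> a b ab /le_trans; apply.
have u2 : upset (fun x : 'I_n'.+1 => (j < x)%O).
  by move=> a b ab /lt_le_trans; apply.
have [|w [_ wu]] := (proj2 po) _ (cut_map u1 ∘ f') (cut_map u1 ∘ g').
  by rewrite -!comp_assoc (proj1 po).
have E1 : w = cut_map u1 by apply: wu.
have E2 : w = cut_map u2.
  apply: wu; split; apply: mono_ext => i /=; congr (if _ then _ else _).
    apply/asboolP/asboolP; first by move/ltW.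
    by rewrite le_eqVlt => /predU1P[ji|//]; case: fj; exists i.
  apply/asboolP/asboolP; first by move/ltW.
  by rewrite le_eqVlt => /predU1P[ji|//]; case: gj; exists i.
have : cut_map u2 j = ord_max by rewrite -E2 E1; apply/cut_mapP; exact: lexx.
by move/cut_mapP; rewrite ltxx.
Qed.

(** An upset of [[n']] containing [g' i] contains [f' k]; without such an [l], a compatible pair of
    cuts would contain the first and miss the second. The next three lemmas follow the same
    pattern. *)
Lemma pushout_le_gf i k : (g' i <= f' k)%O ->
  exists l, (i <= f l)%O /\ (g l <= k)%O.
Proof.
move=> ik; apply: contrapT => nl.
have [|||W [uW WU WV]] := @pushout_cut
  (fun i' => (i <= i')%O \/ exists l, (k < g l)%O /\ (f l <= i')%O)
  (fun k' => (k < k')%O).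
- move=> a b ab [ia|[l [kl la]]]; first by left; exact: le_trans ab.
  by right; exists l; split=> //; exact: le_trans ab.
- by move=> a b ab /lt_le_trans; apply.
- move=> l; split=> [[il|[l' [kl /fle ll]]]|kl].
  + by rewrite ltNge; apply/negP => lk; apply: nl; exists l.
  + exact: lt_le_trans kl (mfun_le g ll).
  + by right; exists l.
have : W (f' k) by apply: uW ik _; apply/WU; left.
by move/WV; rewrite ltxx.
Qed.

Lemma pushout_le_fg k i : (f' k <= g' i)%O ->
  exists l, (k <= g l)%O /\ (f l <= i)%O.
Proof.
move=> ki; apply: contrapT => nl.
have [|||W [uW WU WV]] := @pushout_cut
  (fun i' => exists l, (k <= g l)%O /\ (f l <= i')%O) (fun k' => (k <= k')%O).
- move=> a b ab [l [kl la]].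
  by exists l; split=> //; exact: le_trans ab.
- by move=> a b ab /le_trans; apply.
- move=> l; split=> [[l' [kl /fle ll]]|kl]; last by exists l.
  exact: le_trans kl (mfun_le g ll).
have : W (g' i) by apply: uW ki _; apply/WV; exact: lexx.
by move/WU => [l [kl li]]; apply: nl; exists l.
Qed.

Lemma pushout_le_ff k k' : (f' k <= f' k')%O -> (k <= k')%O.
Proof.
move=> kk; rewrite leNgt; apply/negP => k'k.
have [|||W [uW WU WV]] := @pushout_cut
  (fun i' => exists l, (k' < g l)%O /\ (f l <= i')%O) (fun x => (k' < x)%O).
- move=> a b ab [l [kl la]].
  by exists l; split=> //; exact: le_trans ab.
- by move=> a b ab /lt_le_trans; apply.
- move=> l; split=> [[l' [kl /fle ll]]|kl]; last by exists l.
  exact: lt_le_trans kl (mfun_le g ll).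
have : W (f' k') by apply: uW kk _; apply/WV.
by move/WV; rewrite ltxx.
Qed.

(** Unlike [f'], the map [g'] need not reflect the order, as [g] may identify elements: hence the
    second alternative, a detour through [[n]]. *)
Lemma pushout_le_gg i i' : (g' i <= g' i')%O -> (i <= i')%O \/
  exists l l', [/\ (i <= f l)%O, (g l <= g l')%O & (f l' <= i')%O].
Proof.
move=> ii; apply: contrapT => /not_orP[nii nl].
have [|||W [uW WU WV]] := @pushout_cut
  (fun x => (i <= x)%O \/
     exists l l', [/\ (i <= f l)%O, (g l <= g l')%O & (f l' <= x)%O])
  (fun k => exists l, (i <= f l)%O /\ (g l <= k)%O).
- move=> a b ab [ia|[l [l' [il ll la]]]]; first by left; exact: le_trans ab.
  by right; exists l, l'; split=> //; exact: le_trans ab.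
- by move=> a b ab [l [il la]]; exists l; split=> //; exact: le_trans ab.
- move=> x; split=> [[ix|[l [l' [il ll /fle lx]]]]|[l [il lx]]].
  + by exists x.
  + by exists l; split=> //; exact: le_trans ll (mfun_le g lx).
  + by right; exists l, x.
have : W (g' i') by apply: uW ii _; apply/WU; left.
by move/WU => [//|]; exact: nl.
Qed.

(** Existence in the universal property of the pushout, extended to a target that is only a preorder
    and to legs that agree up to equivalence. The target will be the subobjects of one object. *)
Lemma pushout_extend (S : Type) (le : S -> S -> Prop) (a : 'I_m'.+1 -> S)
    (b : 'I_n.+1 -> S) :
  (forall s, le s s) -> (forall s t u, le s t -> le t u -> le s u) ->
  (forall i j, (i <= j)%O -> le (a i) (a j)) ->
  (forall i j, (i <= j)%O -> le (b i) (b j)) ->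
  (forall l, le (a (f l)) (b (g l)) /\ le (b (g l)) (a (f l))) ->
  exists c : 'I_n'.+1 -> S,
    [/\ forall i j, (i <= j)%O -> le (c i) (c j),
        forall i, le (c (g' i)) (a i) /\ le (a i) (c (g' i))
      & forall k, le (c (f' k)) (b k) /\ le (b k) (c (f' k))].
Proof.
move=> lr lt am bm ab.
(* An index may have several representatives; [rle] shows that they are equivalent, so an arbitrary
   choice is monotone. *)
pose rep j s := (exists i, g' i = j /\ s = a i) \/ (exists k, f' k = j /\ s = b k).
have repP j : exists s, rep j s.
  by case: (pushout_surj j) => -[x xj]; [exists (a x); left|exists (b x); right];
    exists x.
have rle j j' s s' : (j <= j')%O -> rep j s -> rep j' s' -> le s s'.
  move=> jj [[i [ij ->]]|[k [kj ->]]] [[i' [ij' ->]]|[k' [kj' ->]]].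
  - move: jj; rewrite -ij -ij' => /pushout_le_gg[/am //|].
    move=> [l [l' [/am il /bm ll /am li]]].
    have lb : le (b (g l)) (a i') := lt _ _ _ ll (lt _ _ _ (proj2 (ab l')) li).
    by apply: lt il (lt _ _ _ (proj1 (ab l)) lb).
  - move: jj; rewrite -ij -kj' => /pushout_le_gf[l [/am il /bm lk]].
    by apply: lt il (lt _ _ _ (proj1 (ab l)) lk).
  - move: jj; rewrite -kj -ij' => /pushout_le_fg[l [/bm kl /am li]].
    by apply: lt kl (lt _ _ _ (proj2 (ab l)) li).
  - by move: jj; rewrite -kj -kj' => /pushout_le_ff /bm.
pose c j := proj1_sig (cid (repP j)).
have cP j : rep j (c j) by rewrite /c; case: cid.
exists c; split=> [i j ij|i|k]; first exact: rle ij (cP _) (cP _).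
  by split; apply: rle (lexx (g' i)) _ _ => //; left; exists i.
by split; apply: rle (lexx (f' k)) _ _ => //; right; exists k.
Qed.

End DeltaPushout.

(** * Gluing gap complexes *)

Lemma gap_filtration (A : AbelianCategory) d (I : orderType d)
    (F : Functor (Ar I) A) (lo hi : I) (lohi : (lo <= hi)%O) :
  is_gap F -> (forall j, (lo <= j <= hi)%O) ->
  exists (c : I -> sub (F (ar lohi))) (q : forall x, hom (sdom (c (ar_tgt x))) (F x)),
  [/\ presents F c q,
      forall j (jhi : (j <= hi)%O) (f : hom (ar lohi) (ar jhi)),
        is_kernel (c j) (fmap F f)
    & forall (x : Ar I) (xhi : (ar_src x <= hi)%O) (f : hom (ar lohi) (ar xhi))
        (g : hom x (ar xhi)), fmap F g ∘ q x = fmap F f ∘ c (ar_tgt x)].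
Proof.
move=> Fgap bnd.
have idP : is_mono (idm (F (ar lohi))) by move=> w u v; rewrite !comp_idl.
have idP' : is_epi (idm (F (ar lohi))) by move=> w u v; rewrite !comp_idr.
have [c [q [P ck cq]]] := gap_presents Fgap bnd idP idP'.
exists c, q; split=> // [j jhi f|x xhi f g].
  by have [b []] := ck j jhi f; rewrite comp_idl comp_idr => ->.
by rewrite (cq x xhi f g (c (ar_tgt x))) ?comp_idl ?comp_idr.
Qed.

(** Each object is a quotient of some [(lo, t)] object, which embeds in the one at [(lo, hi)]. *)
Lemma gap_faithful (A : AbelianCategory) d (I : orderType d)
    (H H' : Functor (Ar I) A) (lo hi : I) (lohi : (lo <= hi)%O)
    (w w' : NatTrans H H') :
  is_gap H -> is_gap H' -> (forall j, (lo <= j <= hi)%O) ->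
  w (ar lohi) = w' (ar lohi) -> w = w'.
Proof.
move=> gH gH' bnd ww; apply: nt_ext => x.
have /andP[lox _] := bnd (ar_src x).
have /andP[lot hit] := bnd (ar_tgt x).
have e : hom (ar lot) x by rewrite /= /ar_rel /= lox lexx.
have i : hom (ar lot) (ar lohi) by rewrite /= /ar_rel /= hit lexx.
have ee := gap_epi gH (f := e) erefl; apply: ee.
rewrite !nt_natural; congr (_ ∘ _).
by have im := gap_mono gH' (f := i) erefl; apply: im; rewrite -!nt_natural ww.
Qed.

Section Square.
Variables (A : AbelianCategory) (m n m' n' : Delta).
Variables (g : hom m n) (f : hom m m') (f' : hom n n') (g' : hom m' n').
Hypothesis gact : active g.
Hypothesis sq : g' ∘ f = f' ∘ g.
Hypothesis cover : forall j, (exists i, g' i = j) \/ (exists k, f' k = j).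

Let sqE l : g' (f l) = f' (g l).
Proof. exact: (congr1 (fun a : hom m n' => a l) sq). Qed.

Let le0 k (i : 'I_k.+1) : (ord0 <= i)%O.
Proof. by rewrite leEord. Qed.

Let lemax k (i : 'I_k.+1) : (i <= ord_max)%O.
Proof. by rewrite leEord -ltnS ltn_ord. Qed.

Let gbnd k : (g ord0 <= k <= g ord_max)%O.
Proof. by case: gact => -> ->; rewrite le0 lemax. Qed.

(** As [g] is active, the endpoints of [[n]] come from [[m]], so the image of [f'] lies between two
    values of [g']. *)
Lemma square_bounds j : (g' ord0 <= j <= g' ord_max)%O.
Proof.
case: (cover j) => -[x <-]; first by rewrite !mfun_le ?le0 ?lemax.
have /andP[gk kg] := gbnd x.
rewrite (le_trans _ (mfun_le f' gk)) -?sqE ?mfun_le ?le0 //.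
by rewrite (le_trans (mfun_le f' kg)) // -sqE mfun_le ?lemax.
Qed.

Let bnd := square_bounds.

Let lohi : (g' ord0 <= g' ord_max)%O := mfun_le g' (le0 ord_max).

Section Hom.
Variables (H H' : Functor (Ar 'I_n'.+1) A).
Hypotheses (gapH : is_gap H) (gapH' : is_gap H').
Variable u : NatTrans (comp_functor H (ar_functor f')) (comp_functor H' (ar_functor f')).
Variable v : NatTrans (comp_functor H (ar_functor g')) (comp_functor H' (ar_functor g')).
Hypothesis uv : forall (x : Ar 'I_m.+1)
  (e : hom (ar_functor f' (ar_functor g x)) (ar_functor g' (ar_functor f x))),
  v (ar_functor f x) ∘ fmap H e = fmap H' e ∘ u (ar_functor g x).

Let un (x y : Ar 'I_n.+1) (a : hom x y) (b : hom (ar_functor f' x) (ar_functor f' y)) :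
  u y ∘ fmap H b = fmap H' b ∘ u x.
Proof.
have := nt_natural u a; rewrite /=.
by rewrite (bool_irrelevance b (fmap (ar_functor f') a)).
Qed.

Let vn (x y : Ar 'I_m'.+1) (a : hom x y) (b : hom (ar_functor g' x) (ar_functor g' y)) :
  v y ∘ fmap H b = fmap H' b ∘ v x.
Proof.
have := nt_natural v a; rewrite /=.
by rewrite (bool_irrelevance b (fmap (ar_functor g') a)).
Qed.

(** The arrow [a] leads from the [g'] part to the [f'] part; it factors through the image of [z],
    where the parts meet and [uv] applies, read along the inverse of [e]. *)
Let uv_mid k (kg : (k <= g ord_max)%O)
    (a : hom (ar_functor g' (ar (le0 (f ord_max)))) (ar_functor f' (ar kg))) :
  u (ar kg) ∘ fmap H a = fmap H' a ∘ v (ar (le0 (f ord_max))).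
Proof.
pose z : Ar 'I_m.+1 := ar (le0 ord_max).
have b : hom (ar (le0 (f ord_max))) (ar_functor f z).
  exact: introT andP (conj (le0 _) (lexx _)).
have d : hom (ar_functor g z) (ar kg).
  by apply/andP; split; [case/andP: (gbnd k)|exact: lexx].
have e : hom (ar_functor f' (ar_functor g z)) (ar_functor g' (ar_functor f z)).
  by apply/andP; split; rewrite /= sqE.
have e' : hom (ar_functor g' (ar_functor f z)) (ar_functor f' (ar_functor g z)).
  by apply/andP; split; rewrite /= sqE.
pose b' := fmap (ar_functor g') b; pose d' := fmap (ar_functor f') d.
have ue : u (ar_functor g z) ∘ fmap H e' = fmap H' e' ∘ v (ar_functor f z).
  rewrite -[LHS]comp_idl -(ar_id H' (comp e' e)) -(ar_comp H' e' e) -comp_assoc.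
  rewrite (comp_assoc (fmap H' e)) -uv -!comp_assoc (ar_comp H e e' (idm _)).
  by rewrite fmap_id comp_idr.
rewrite -(ar_comp H d' (comp e' b')) -(ar_comp H e' b').
rewrite (comp_assoc (u _)) (un d d') -comp_assoc (comp_assoc (u _)) ue.
rewrite -comp_assoc (vn b b').
by rewrite (ar_compA H' e' b' (comp e' b')) (ar_compA H' d' _ a).
Qed.

Lemma gap_square_full : exists w : NatTrans H H',
  (forall x, w (ar_functor f' x) = u x) /\ (forall x, w (ar_functor g' x) = v x).
Proof.
have [c [q [P ck cq]]] := gap_filtration lohi gapH bnd.
have [c' [q' [P' ck' cq']]] := gap_filtration lohi gapH' bnd.
pose h := v (ar (le0 ord_max)).
have jhi j : (j <= g' ord_max)%O by case/andP: (bnd j).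
have loj j : (g' ord0 <= j)%O by case/andP: (bnd j).
have gk k : (k <= g ord_max)%O by case/andP: (gbnd k).
have f'g k : (f' k <= g' (f ord_max))%O by rewrite sqE; exact: mfun_le.
pose y : Ar 'I_m'.+1 := ar (le0 (f ord_max)).
have yT : hom y (ar (le0 ord_max)) by exact: introT andP (conj (lexx _) (lemax _)).
pose i : hom (ar_functor g' y) (ar lohi) := fmap (ar_functor g') yT.
have a k : hom (ar_functor g' y) (ar_functor f' (ar (gk k))).
  by apply/andP; split=> /=; [exact: loj|rewrite -sqE].
have l k : hom (ar_functor f' (ar (gk k))) (ar (jhi (f' k))).
  by apply/andP; split=> /=; [exact: lexx|exact: jhi].
have lm k : is_mono (fmap H (l k)) by exact: gap_mono.
(* As [f' k] is at most [g' (f ord_max)], the step at [f' k] lies in the object at [g' y], from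
   which [uv_mid] leads to the [f'] part. *)
have lift k : exists z : hom (sdom (c (f' k))) (H (ar_functor g' y)),
    fmap H i ∘ z = c (f' k).
  have b : hom (ar lohi) (ar (jhi (f' k))).
    by apply/andP; split; [exact: loj|exact: lexx].
  have b' : hom (ar (jhi (f' k))) (ar (jhi (g' (f ord_max)))).
    by apply/andP; split; [exact: f'g|exact: lexx].
  apply: (gap_exact gapH i (g := comp b' b)) => //.
  by rewrite fmap_comp -comp_assoc (proj1 (ck _ _ _)) comp0r.
have hc j : exists r, c' j ∘ r = h ∘ c j.
  (* The step [c' j] is the kernel of the map to [H'(j, g' ord_max)], so [h] respects the
     filtrations once [h] composed with [c j] dies there. *)
  suff [jh [b E]] : exists (jh : (j <= g' ord_max)%O) (b : hom (ar lohi) (ar jh)),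
      fmap H' b ∘ (h ∘ c j) = hzero _ _.
    by have [r [rP _]] := (proj2 (ck' j jh b)) _ _ E; exists r.
  case: (cover j) => -[k kj]; subst j.
    have b : hom (ar (le0 ord_max)) (ar (lemax k)).
      exact: introT andP (conj (le0 _) (lexx _)).
    exists (mfun_le g' (lemax k)), (fmap (ar_functor g') b).
    by rewrite comp_assoc -(vn b) -comp_assoc (proj1 (ck _ _ _)) comp0r.
  have b : hom (ar lohi) (ar (jhi (f' k))).
    by apply/andP; split; [exact: loj|exact: lexx].
  exists (jhi (f' k)), b; have [z zP] := lift k.
  have az : fmap H (a k) ∘ z = hzero _ _.
    apply: (mono_eq0 (lm k)); rewrite (ar_compA H _ _ (comp b i)).
    by rewrite fmap_comp -comp_assoc zP (proj1 (ck _ _ _)).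
  rewrite -zP (comp_assoc h) (vn yT) -comp_assoc (ar_compA H' _ _ (comp (l k) (a k))).
  by rewrite fmap_comp -comp_assoc (comp_assoc _ (v y)) -uv_mid -comp_assoc az !comp0r.
have [w wP] := presents_map P P' hc.
(* Each component is compared after the epic [q] and before a monic to the object of [H'] with the
   same source and target [g' ord_max], where [w] is computed from [h]. *)
exists w; split=> x; apply: (presents_epi P).
  have [z zP] := lift (ar_tgt x); have [r rP] := hc (f' (ar_tgt x)).
  have b : hom (ar lohi) (ar (jhi (f' (ar_src x)))).
    by apply/andP; split; [exact: loj|exact: lexx].
  have e : hom x (ar (gk (ar_src x))) by exact: introT andP (conj (lexx _) (gk _)).
  pose e' := fmap (ar_functor f') e.
  have lem : is_mono (fmap H' (comp (l (ar_src x)) e')) by exact: gap_mono.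
  apply: lem; rewrite (wP (ar_functor f' x) r rP).
  rewrite comp_assoc (cq' (ar_functor f' x) _ b) -comp_assoc rP.
  rewrite -zP (comp_assoc h) (vn yT) -comp_assoc (ar_compA H' _ _ (comp (l _) (a _))).
  rewrite !fmap_comp -!comp_assoc; congr (_ ∘ _).
  rewrite (comp_assoc (fmap H' e')) -(un e) (comp_assoc _ (v y)) -uv_mid.
  rewrite -!comp_assoc; congr (_ ∘ _).
  apply: lm; rewrite (ar_compA H _ _ (comp b i)) (ar_compA H _ _ (comp (l _) e')).
  by rewrite [in RHS](cq (ar_functor f' x) _ b) fmap_comp -comp_assoc zP.
have [r rP] := hc (g' (ar_tgt x)).
have b : hom (ar (le0 ord_max)) (ar (lemax (ar_src x))).
  exact: introT andP (conj (le0 _) (lexx _)).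
have e : hom x (ar (lemax (ar_src x))).
  exact: introT andP (conj (lexx _) (lemax _)).
pose b' := fmap (ar_functor g') b; pose e' := fmap (ar_functor g') e.
have em : is_mono (fmap H' e') by exact: gap_mono.
apply: em; rewrite (wP (ar_functor g' x) r rP).
rewrite comp_assoc (cq' (ar_functor g' x) _ b') -comp_assoc rP.
rewrite (comp_assoc _ (v x)) -(vn e) -comp_assoc (cq (ar_functor g' x) _ b').
by rewrite comp_assoc -(vn b) comp_assoc.
Qed.

End Hom.
End Square.

Lemma presents_restrict (A : AbelianCategory) d (I : orderType d) d'
    (J : orderType d') (K : Functor (Ar J) A) (T : A) (c : J -> sub T) q
    (a : MonoMap I J) :
  presents K c q ->
  presents (comp_functor K (ar_functor a)) (c \o a) (fun x => q (ar_functor a x)).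
Proof.
case=> cm qc qn; split=> [i j ij|x t ct|x y f t ct].
- exact/cm/mfun_le.
- exact: qc (ar_functor a x) t ct.
- exact: qn (fmap (ar_functor a) f) t ct.
Qed.

Section Glue.
Variables (A : AbelianCategory) (m n m' n' : Delta).
Variables (g : hom m n) (f : hom m m') (f' : hom n n') (g' : hom m' n').
Hypotheses (gact : active g) (finert : inert f) (po : is_pushout g f g' f').
Variables (F : Functor (Ar 'I_n.+1) A) (G : Functor (Ar 'I_m'.+1) A).
Hypotheses (gapF : is_gap F) (gapG : is_gap G).
Variable theta : @Iso (functor_cat (Ar 'I_m.+1) A)
  (comp_functor F (ar_functor g)) (comp_functor G (ar_functor f)).

Let le0 k (i : 'I_k.+1) : (ord0 <= i)%O.
Proof. by rewrite leEord. Qed.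

Let lemax k (i : 'I_k.+1) : (i <= ord_max)%O.
Proof. by rewrite leEord -ltnS ltn_ord. Qed.

Let th : NatTrans (comp_functor F (ar_functor g)) (comp_functor G (ar_functor f)) :=
  iso_hom theta.

Let ti : NatTrans (comp_functor G (ar_functor f)) (comp_functor F (ar_functor g)) :=
  iso_inv theta.

Let thi x : th x ∘ ti x = idm (G (ar_functor f x)).
Proof. exact: (congr1 (fun s : NatTrans _ _ => s x) (iso_invr theta)). Qed.

Let tih x : ti x ∘ th x = idm (F (ar_functor g x)).
Proof. exact: (congr1 (fun s : NatTrans _ _ => s x) (iso_invl theta)). Qed.

Lemma gap_square_glue : exists (H : Functor (Ar 'I_n'.+1) A)
    (u : @Iso (functor_cat _ A) (comp_functor H (ar_functor f')) F)
    (v : @Iso (functor_cat _ A) (comp_functor H (ar_functor g')) G),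
  is_gap H /\ forall (x : Ar 'I_m.+1)
    (e : hom (ar_functor f' (ar_functor g x)) (ar_functor g' (ar_functor f x))),
    (iso_hom v : NatTrans _ _) (ar_functor f x) ∘ fmap H e =
    th x ∘ (iso_hom u : NatTrans _ _) (ar_functor g x).
Proof.
have bnd k (j : 'I_k.+1) : (ord0 <= j <= ord_max)%O by rewrite le0 lemax.
have gbnd k : (g ord0 <= k <= g ord_max)%O by case: gact => -> ->; exact: bnd.
have [a [qa [Pa ka ea]]] := gap_filtration (le0 ord_max) gapG (bnd _).
pose z : Ar 'I_m.+1 := ar (le0 ord_max).
pose y : Ar 'I_m'.+1 := ar (le0 (f ord_max)).
have yT : hom y (ar (le0 ord_max)) by exact: introT andP (conj (lexx _) (lemax _)).
have yz : hom y (ar_functor f z) by exact: introT andP (conj (le0 _) (lexx _)).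
(* The quotient map onto [G(f 0, f m)] followed by the inverse of [theta]. As [yT] embeds [G y] in
   the top object of [G], the filtration of [F] is moved to that same object. *)
pose p : hom (G y) (F (ar (mfun_le g (le0 ord_max)))) := ti z ∘ fmap G yz.
have ym : is_mono (fmap G yT) by exact: gap_mono.
have pe : is_epi p.
  have yze : is_epi (fmap G yz) by exact: gap_epi.
  move=> w s t; rewrite !comp_assoc => /yze st.
  by rewrite -[s]comp_idr -[t]comp_idr -(tih z) !comp_assoc st.
have [b [qb [Pb kb eb]]] := gap_presents gapF gbnd ym pe.
have zl l : hom z (ar (lemax l)) by exact: introT andP (conj (le0 _) (lexx _)).
pose gz l := fmap (ar_functor g) (zl l).
pose fz l := fmap (ar_functor f) (zl l).
have pE l : fmap F (gz l) ∘ p = ti (ar (lemax l)) ∘ fmap G (comp (fz l) yz).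
  by rewrite comp_assoc fmap_comp comp_assoc -(nt_natural ti (zl l)).
have T0 l : hom (ar (le0 ord_max)) (ar (lemax (f l))).
  exact: introT andP (conj (le0 _) (lexx _)).
have k0 l : hom (ar_functor f (ar (lemax l))) (ar (lemax (f l))).
  exact: introT andP (conj (lexx _) (lemax _)).
have km l : is_mono (fmap G (k0 l)) by exact: gap_mono.
(* Inside [G y] both steps are the kernel of the map to [G(f l, f m)]: for [b] by [pE], as [ti] is
   invertible, and for [a] because [k0 l] is monic. *)
have ab l : sle (a (f l)) (b (g l)) /\ sle (b (g l)) (a (f l)).
  have [beta [betaE kbeta]] := kb (g l) (mfun_le g (lemax l)) (gz l).
  split.
    have ymax : hom (ar (lemax (f l))) (ar (lemax (f ord_max))).
      exact: introT andP (conj (mfun_le f (lemax l)) (lexx _)).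
    have [||||s sP] := gap_exact gapG yT (g := comp ymax (T0 l)) (u := a (f l)) => //.
      by rewrite fmap_comp -comp_assoc (proj1 (ka _ _ _)) comp0r.
    have [|r [rP _]] := (proj2 kbeta) _ s.
      rewrite pE -comp_assoc; have -> : fmap G (comp (fz l) yz) ∘ s = hzero _ _.
        apply: (mono_eq0 (km l)); rewrite (ar_compA G _ _ (comp (T0 l) yT)).
        by rewrite fmap_comp -comp_assoc sP (proj1 (ka _ _ _)).
      exact: comp0r.
    by exists r; rewrite -betaE -comp_assoc rP.
  have [|r [rP _]] := (proj2 (ka _ _ (T0 l))) _ (b (g l)); last by exists r.
  rewrite -betaE (ar_compA G _ _ (comp (k0 l) (comp (fz l) yz))) fmap_comp -comp_assoc.
  suff -> : fmap G (comp (fz l) yz) ∘ beta = hzero _ _ by rewrite comp0r.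
  rewrite -[LHS]comp_idl -(thi (ar (lemax l))) -comp_assoc (comp_assoc _ _ beta) -pE.
  by rewrite (proj1 kbeta) comp0r.
have [||||| c [cm ca cb]] := pushout_extend (inert_le finert) po
  (le := @sle A _) (a := a) (b := b).
- by move=> s; exists (idm _); rewrite comp_idr.
- move=> s s' s'' [r rP] [r' rP']; exists (r' ∘ r).
  by rewrite comp_assoc rP' rP.
- by case: Pa.
- by case: Pb.
- exact: ab.
have [H [q PH]] := presents_exists cm.
have [||u uP] := presents_iso (presents_restrict f' PH) Pb.
- by move=> k; case: (cb k).
- by move=> k; case: (cb k).
have [||v vP] := presents_iso (presents_restrict g' PH) Pa.
- by move=> k; case: (ca k).
- by move=> k; case: (ca k).
exists H, u, v; split; first exact: presents_gap PH.
(* Compatibility with [theta] is tested after the epic [q] and before a monic into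
   [G(f (ar_src x), m')]; both sides become the restriction of [T0] to a filtration step. *)
move=> x e; apply: (presents_epi PH).
have [_ _ qn] := PH; have /andP[_ /cm[t tP]] := e.
have [r rP] := (proj1 (ca (f (ar_tgt x)))).
have [r' rP'] := (proj1 (cb (g (ar_tgt x)))).
rewrite -!comp_assoc (qn _ _ e t tP) (uP (ar_functor g x) r' rP').
rewrite (comp_assoc _ _ t) (vP (ar_functor f x) r rP).
have gamma : hom x (ar (lemax (ar_src x))).
  exact: introT andP (conj (lexx _) (lemax _)).
pose fgamma := fmap (ar_functor f) gamma; pose ggamma := fmap (ar_functor g) gamma.
have gm : is_mono (fmap G (comp (k0 (ar_src x)) fgamma)) by exact: gap_mono.
have [beta [betaE kbeta]] := kb (g (ar_tgt x)) (mfun_le g (lemax (ar_tgt x))) (gz _).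
apply: gm.
transitivity (fmap G (T0 (ar_src x)) ∘ c (f' (g (ar_tgt x)))).
  rewrite !(comp_assoc (fmap G (comp (k0 (ar_src x)) fgamma))).
  by rewrite (ea (ar_functor f x) _ (T0 _)) -!comp_assoc (comp_assoc _ r) rP tP.
rewrite fmap_comp -comp_assoc (comp_assoc _ (th x)) -(nt_natural th gamma).
rewrite -comp_assoc (comp_assoc _ _ r').
rewrite (eb (ar_functor g x) _ (gz (ar_src x)) ggamma beta betaE) pE.
rewrite -!comp_assoc (comp_assoc (th _)) thi comp_idl.
rewrite (ar_compA G _ _ (comp (T0 _) yT)) fmap_comp.
by rewrite -comp_assoc (comp_assoc (fmap G yT)) betaE rP'.
Qed.

End Glue.

(** * From transports along the strict square to structure maps *)

Lemma ar_anti d (I : orderType d) (x y : Ar I) : hom x y -> hom y x -> x = y.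
Proof.
case: x y => i j ij [i' j' ij'] /= /andP[/= i1 j1] /andP[/= i2 j2].
have ii : i = i' by apply: le_anti; rewrite i1.
have jj : j = j' by apply: le_anti; rewrite j1.
by subst i' j'; rewrite (bool_irrelevance ij ij').
Qed.

Lemma hcast_idm_ar (A : Category) d (I : orderType d) (H : Functor (Ar I) A)
  (x y : Ar I) (p : H x = H y) (e : hom x y) : hom y x ->
  hcast erefl p (idm (H x)) = fmap H e.
Proof.
by move=> /(ar_anti e) xy; subst y; rewrite hcast_id ar_id.
Qed.

Section CoreGap.
Variable A : Category.

Let core_gap m n (a : @hom Delta m n) :
    Functor (core (Gap 'I_n.+1 A)) (core (Gap 'I_m.+1 A)) :=
  core_functor (gap_functor A a).

Lemma core_gap_comp l m n (b : @hom Delta m n) (a : @hom Delta l m) :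
  comp_functor (core_gap a) (core_gap b) = core_gap (b ∘ a).
Proof.
apply: (gap_diagram_ext (c := comp_functor (core_gap a) (core_gap b))) => [F|F G s x p q].
  apply: gap_eq; set H := proj1_sig F.
  apply: (@functor_ext _ _
    (comp_functor (comp_functor H (ar_functor b)) (ar_functor a))
    (comp_functor H (ar_functor (mono_comp b a))) (fun=> erefl)) => x y f /=.
  by congr (fmap _ _); exact: bool_irrelevance.
by rewrite hcast_id.
Qed.

Lemma core_gap_square m n m' n' (g : @hom Delta m n) (f : @hom Delta m m')
    (f' : @hom Delta n n') (g' : @hom Delta m' n') : f' ∘ g = g' ∘ f ->
  comp_functor (core_gap g) (core_gap f') = comp_functor (core_gap f) (core_gap g').
Proof. by move=> sq; rewrite !core_gap_comp sq. Qed.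

(** The bridge to the gluing lemmas, whose compatibility conditions are stated with arrows of [Ar]:
    these arrows run both ways here, so [hcast_idm_ar] removes the transport along [E]. *)
Lemma core_gap_square_nt m n m' n' (g : @hom Delta m n) (f : @hom Delta m m')
    (f' : @hom Delta n n') (g' : @hom Delta m' n')
    (E : comp_functor (core_gap g) (core_gap f') =
         comp_functor (core_gap f) (core_gap g'))
    (H : core (Gap 'I_n'.+1 A)) (x : Ar 'I_m.+1)
    (e : hom (ar_functor f' (ar_functor g x)) (ar_functor g' (ar_functor f x))) :
  f' ∘ g = g' ∘ f ->
  (iso_hom (functor_eq_nt E H) : NatTrans _ _) x = fmap (proj1_sig H) e.
Proof.
move=> sq.
have key (X Y : core (Gap 'I_m.+1 A)) (P : X = Y) (Q : proj1_sig X x = proj1_sig Y x) :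
    nt (iso_hom (hcast erefl P (idm X))) x = hcast erefl Q (idm (proj1_sig X x)).
  by subst Y; rewrite !hcast_id.
have sqE l : f' (g l) = g' (f l) by exact: (congr1 (fun a : hom m n' => a l) sq).
have e' : hom (ar_functor g' (ar_functor f x)) (ar_functor f' (ar_functor g x)).
  by apply/andP; split; rewrite /= sqE.
have Q : proj1_sig H (ar_functor f' (ar_functor g x)) =
    proj1_sig H (ar_functor g' (ar_functor f x)) by rewrite (ar_anti e e').
rewrite -(hcast_idm_ar Q e e').
exact: (key _ _ (congr1 (fun R : Functor (core (Gap 'I_n'.+1 A))
                                   (core (Gap 'I_m.+1 A)) => R H) E) Q).
Qed.

End CoreGap.

(** Isomorphisms in the full subcategory and in the functor category carry the same data in
    different types; this and [iso_gap] pass between them. *)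
Definition gap_iso (A : Category) d (I : orderType d) (F G : Gap I A)
    (s : @Iso (functor_cat (Ar I) A) (proj1_sig F) (proj1_sig G)) :
  @hom (core (Gap I A)) F G :=
  @Build_Iso (Gap I A) F G (iso_hom s) (iso_inv s) (iso_invl s) (iso_invr s).

Definition iso_gap (A : Category) d (I : orderType d) (F G : Gap I A)
    (s : @hom (core (Gap I A)) F G) :
  @Iso (functor_cat (Ar I) A) (proj1_sig F) (proj1_sig G) :=
  @Build_Iso (functor_cat (Ar I) A) _ _ (iso_hom s) (iso_inv s) (iso_invl s)
    (iso_invr s).

Definition gap_iso_at (A : Category) d (I : orderType d) (F G : core (Gap I A))
    (s : hom F G) (x : Ar I) : hom (proj1_sig F x) (proj1_sig G x) :=
  nt (iso_hom s) x.

Lemma gap_iso_at_ginvl (A : Category) d (I : orderType d)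
    (F G : core (Gap I A)) (s : hom F G) (x : Ar I) :
  gap_iso_at (ginv s) x ∘ gap_iso_at s x = idm (proj1_sig F x).
Proof.
exact: (congr1 (fun t : @hom (core (Gap I A)) _ _ => gap_iso_at t x) (ginvl s)).
Qed.

Lemma gap_iso_at_ginvr (A : Category) d (I : orderType d)
    (F G : core (Gap I A)) (s : hom F G) (x : Ar I) :
  gap_iso_at s x ∘ gap_iso_at (ginv s) x = idm (proj1_sig G x).
Proof.
exact: (congr1 (fun t : @hom (core (Gap I A)) _ _ => gap_iso_at t x) (ginvr s)).
Qed.

Theorem theorem10p10 (A : AbelianCategory) :
  decomposition_space (waldhausen A).
Proof.
move=> m n m' n' g f f' g' gact finert po.
have sq : f' ∘ g = g' ∘ f by case: po.
have E := core_gap_square A sq.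
have cover := pushout_surj po.
have ntE := @core_gap_square_nt A _ _ _ _ g f f' g' E.
have le0m : ((ord0 : 'I_m'.+1) <= ord_max)%O by rewrite leEord.
(* The top object sits at an image under [ar_functor g'], so restriction along [g'] is already
   faithful. *)
have inj (H H' : core (Gap 'I_n'.+1 A))
    (w w' : NatTrans (proj1_sig H) (proj1_sig H')) :
    (forall x, w (ar_functor g' x) = w' (ar_functor g' x)) -> w = w'.
  move=> ww; apply: (gap_faithful (lohi := mfun_le g' le0m) (proj2_sig H) (proj2_sig H')).
    exact: (square_bounds gact (esym sq) cover).
  exact: (ww (ar le0m)).
apply: (nerve_homotopy_pullback (sq := E)).
- have full (H H' : core (Gap 'I_n'.+1 A)) (s : hom (to_icomma E H) (to_icomma E H')) :
      exists w : NatTrans (proj1_sig H) (proj1_sig H'),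
        (forall x, w (ar_functor f' x) = gap_iso_at (ih_l s) x) /\
        (forall x, w (ar_functor g' x) = gap_iso_at (ih_r s) x).
    apply: (gap_square_full gact (esym sq) cover (proj2_sig H) (proj2_sig H')) => x e.
    have := congr1 (fun t : @hom (core (Gap 'I_m.+1 A)) _ _ => gap_iso_at t x) (ih_sq s).
    rewrite -(ntE H x e sq) -(ntE H' x e sq).
    exact.
  move=> H H' s; have [w [wf wg]] := full H H' s.
  (* [full] yields a mere natural transformation; lifting the inverse of [s] too makes it
     invertible, by [inj]. *)
  have [w' [wf' wg']] := full H' H (ginv s).
  have w'w : @comp (functor_cat _ A) _ _ _ w' w = @idm (functor_cat _ A) (proj1_sig H).
    by apply: (inj H H) => x /=; rewrite wg wg'; exact: (gap_iso_at_ginvl (ih_r s) x).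
  have ww' : @comp (functor_cat _ A) _ _ _ w w' = @idm (functor_cat _ A) (proj1_sig H').
    by apply: (inj H' H') => x /=; rewrite wg wg'; exact: (gap_iso_at_ginvr (ih_r s) x).
  exists (gap_iso (@Build_Iso (functor_cat _ A) _ _ w w' w'w ww')); split.
    apply: icomma_hom_ext; apply: iso_ext; apply: nt_ext => x.
      exact: wf.
    exact: wg.
  move=> t ts; apply: iso_ext; apply: inj => x.
  rewrite [LHS]wg -ts.
  by [].
- move=> [F G theta].
  have [H [u [v [gapH uv]]]] := gap_square_glue gact finert po (proj2_sig F)
    (proj2_sig G) (iso_gap theta).
  pose H' : core (Gap 'I_n'.+1 A) := exist _ H gapH.
  exists H'; apply: inhabits.
  refine (@Build_icomma_hom _ _ _ _ _ (to_icomma E H')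
     {| ic_l := F; ic_r := G; ic_iso := theta |}
     (@gap_iso _ _ _ (gap_functor A f' H') F u)
     (@gap_iso _ _ _ (gap_functor A g' H') G v) _).
  apply: iso_ext; apply: nt_ext => x.
  have e : hom (ar_functor f' (ar_functor g x)) (ar_functor g' (ar_functor f x)).
    have sqE l : f' (g l) = g' (f l) by exact: (congr1 (fun a : hom m n' => a l) sq).
    by apply/andP; split; rewrite /= sqE.
  have := uv x e; rewrite -(ntE H' x e sq).
  exact.
Qed.
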